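(* Let $n\in\mathbb{N}$ and $r,s\in\mathbb{N}_0$. A mixture of $r$ Gaussians $(\mathcal{N}(\mu_i,\Sigma_i))_{i=1,\ldots,r}$ and $s$ Laplace distributions $(L(\mu_{r+i},\Sigma_{r+i}))_{i=1,\ldots,s}$ on $\mathbb{R}^n$ is algebraically identifiable from degree $5$ moments, if $$r+s\le\frac{\binom{n+4}{5}}{\binom{n+1}{2}+n}-\left(\binom{n+1}{2}+n\right).$$
   Context: Let $t=(t_1,\ldots,t_n)$ be variables. For $\mu\in\mathbb{C}^n$ and a symmetric matrix $\Sigma\in\mathbb{C}^{n\times n}$ put $\ell_\mu=t^T\mu$ and $q_\Sigma=t^T\Sigma t$. The degree-$5$ moment forms of the Gaussian distribution $\mathcal{N}(\mu,\Sigma)$ (mean $\mu$, covariance matrix $\Sigma$) and of the symmetric multivariate Laplace distribution $L(\mu,\Sigma)$ (mean $\mu$, scale matrix $\Sigma$, characteristic function $t\mapsto \exp(\mathrm{i}\,\mu^Tt)/(1+\tfrac12t^T\Sigma t)$) are $$\mathcal{M}_5(\mathcal{N}(\mu,\Sigma))=\ell_\mu^5+10q_\Sigma\ell_\mu^3+15q_\Sigma^2\ell_\mu,\qquad \mathcal{M}_5(L(\mu,\Sigma))=\ell_\mu^5+10q_\Sigma\ell_\mu^3+30q_\Sigma^2\ell_\mu,$$ elements of $\mathbb{C}[t_1,\ldots,t_n]_5$. These expressions are used for all complex parameters. The mixture is algebraically identifiable from degree $5$ moments if, for general parameters $(\mu_i,\Sigma_i)_{i=1,\ldots,r+s}$,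 the degree-$5$ moments determine the parameters up to finitely many possibilities; that is, the general (nonempty) fiber of the polynomial map $$(\mu_i,\Sigma_i)_{i=1}^{r+s}\longmapsto\sum_{i=1}^{r}\mathcal{M}_5(\mathcal{N}(\mu_i,\Sigma_i))+\sum_{i=1}^{s}\mathcal{M}_5(L(\mu_{r+i},\Sigma_{r+i}))\in\mathbb{C}[t_1,\ldots,t_n]_5,$$ with $\mu_i\in\mathbb{C}^n$ and $\Sigma_i\in\mathbb{C}^{n\times n}$ symmetric, is finite. *)

(* Defs.v *)
From mathcomp Require Import all_boot all_order all_algebra.
From mathcomp Require Import mpoly complex.
From mathcomp Require Import classical_sets cardinality reals.

Set Implicit Arguments.
Unset Strict Implicit.
Unset Printing Implicit Defensive.

Import GRing.Theory.

Local Open Scope ring_scope.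
Local Open Scope complex_scope.

Section Moments.
Variables (K : comNzRingType) (n : nat).

Definition mean_form (mu : 'cV[K]_n) : {mpoly K[n]} :=
  \sum_(i < n) mu i 0 *: 'X_i.

Definition cov_form (Sigma : 'M[K]_n) : {mpoly K[n]} :=
  \sum_(i < n) \sum_(j < n) Sigma i j *: ('X_i * 'X_j).

Definition gauss5 (mu : 'cV[K]_n) (Sigma : 'M[K]_n) : {mpoly K[n]} :=
  mean_form mu ^+ 5 + 10%:R *: (cov_form Sigma * mean_form mu ^+ 3)
    + 15%:R *: (cov_form Sigma ^+ 2 * mean_form mu).

Definition laplace5 (mu : 'cV[K]_n) (Sigma : 'M[K]_n) : {mpoly K[n]} :=
  mean_form mu ^+ 5 + 10%:R *: (cov_form Sigma * mean_form mu ^+ 3)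
    + 30%:R *: (cov_form Sigma ^+ 2 * mean_form mu).

(* Arbitrary square matrices are allowed here; the parameter space of the
   mixture is the linear subspace [sym_params]. *)
Definition params (m : nat) := {ffun 'I_m -> 'cV[K]_n * 'M[K]_n}.

Definition sym_params (m : nat) : set (params m) :=
  [set theta | forall i, (theta i).2^T = (theta i).2].

Definition mixture5 (r s : nat) (theta : params (r + s)) : {mpoly K[n]} :=
  \sum_(i < r) gauss5 (theta (lshift s i)).1 (theta (lshift s i)).2
  + \sum_(i < s) laplace5 (theta (rshift r i)).1 (theta (rshift r i)).2.

Definition mixture5_fiber (r s : nat) (f : {mpoly K[n]}) :
    set (params (r + s)) :=
  [set theta | sym_params theta /\ mixture5 theta = f].

Definition coords (m : nat) (theta : params m) : 'I_(m * (n + n * n)) -> K :=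
  mxvec (\matrix_(i < m) row_mx (theta i).1^T (mxvec (theta i).2)) 0.

(* [Q] holds on a nonempty Zariski-open subset of [sym_params], which is dense
   since [sym_params] is a linear space, hence irreducible over an infinite
   field. [P] is a polynomial in all entries of the Sigma_i, so [P != 0] would
   not suffice: it has to be nonzero somewhere on [sym_params]. *)
Definition for_general_params (m : nat) (Q : params m -> Prop) : Prop :=
  exists P : {mpoly K[m * (n + n * n)]},
    (exists2 theta, sym_params theta & P.@[coords theta] != 0) /\
    (forall theta, sym_params theta -> P.@[coords theta] != 0 -> Q theta).

End Moments.

Arguments mixture5 {K n} r s theta.
Arguments mixture5_fiber {K n} r s f.

Definition algebraically_identifiable5 (K : comNzRingType) (n r s : nat) : Prop :=
  for_general_params (fun theta : params K n (r + s) =>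
    finite_set (mixture5_fiber r s (mixture5 r s theta))).

(* Main.v *)
(** The tangent space at a parameter (l, q) of a single component is the space of all
    A l' + B q' with l' linear and q' quadratic, where A = 5 l^4 + 30 q l^2 + c q^2 and
    B = 10 l^3 + 2 c q l (c = 15 for Gaussians, c = 30 for Laplace distributions).  It has
    dimension N = C(n+1,2) + n in general.  The point is that the tangent spaces at r + s
    general parameters are linearly independent.

    Otherwise, for some r' + s' < r + s, the sum W of r' + s' general tangent spaces meets
    the general tangent space T of one of the two types.  Adding a general tangent space to
    W can only enlarge W ∩ T.  If neither type enlarges it, then exchanging the summands
    of W one by one shows that W ∩ T does not depend on W; hence a nonzero vector of it,
    together with its whole GL_n-orbit, lies in a fixed general W, and W is the space of
    all quintics, since these form an irreducible representation.  So after adding fewer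
    than N further tangent spaces everything is filled, and the quintics would have
    dimension less than (r + s + N) N, against the hypothesis.

    Independence of the tangent spaces means that the differential of the moment map is
    injective at some point.  Composing with a linear map makes the source and the target
    of equal dimension M.  Every coordinate x_j then satisfies a polynomial relation
    H_j(x_j, F_1, ..., F_M) = 0 which at a general point v has a nonzero derivative in
    x_j; the roots of H_j(z, F(v)) are the only values of x_j on the fiber through v. *)

From HB Require Import structures.
Require Import Defs.
From mathcomp Require Import all_boot all_order all_algebra.
From mathcomp Require Import boolp classical_sets cardinality.
From mathcomp Require Import mpoly ring zify.
From mathcomp Require Import complex reals.

Set Implicit Arguments.
Unset Strict Implicit.
Unset Printing Implicit Defensive.

Import Order.TTheory GRing.Theory Num.Theory.

Local Open Scope ring_scope.

(** * Polynomials in characteristic zero: nonroots, induction, derivatives *)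

Lemma poly_nonroot (K : numDomainType) (p : {poly K}) :
  p != 0 -> exists t, p.[t] != 0.
Proof.
move=> p0; pose s : seq K := [seq i%:R | i <- iota 0 (size p)].
have us : uniq s by rewrite map_inj_uniq ?iota_uniq //; apply: mulrIn (oner_neq0 _).
have [/(max_poly_roots p0)/(_ us)|] := boolP (all (root p) s).
  by rewrite size_map size_iota ltnn.
by case/allPn => t _ pt; exists t.
Qed.

Lemma horner_mmap (R : comNzRingType) (n : nat) (g : 'I_n -> {poly R}) (p : {mpoly R[n]}) (t : R) :
  (mmap polyC g p).[t] = p.@[fun i => (g i).[t]].
Proof.
rewrite /meval /mmap horner_sum; apply: eq_bigr => m _.
rewrite hornerM hornerC; congr (_ * _).
by rewrite /mmap1 horner_prod; apply: eq_bigr => i _; rewrite horner_exp.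
Qed.

(** Uniqueness of base [B] expansions: reduction modulo [B] isolates the lowest digit, and induction
    treats the rest. *)
Lemma digits_inj (B n : nat) (f g : 'I_n -> nat) :
  (forall i, f i < B)%N -> (forall i, g i < B)%N ->
  (\sum_(i < n) f i * B ^ i = \sum_(i < n) g i * B ^ i)%N -> f =1 g.
Proof.
elim: n f g => [|n IHn] f g fB gB; first by move=> _ [].
have shift (h : 'I_n.+1 -> nat) : (\sum_(i < n.+1) h i * B ^ i =
    h ord0 + (\sum_(i < n) h (lift ord0 i) * B ^ i) * B)%N.
  rewrite big_ord_recl /= expn0 muln1; congr addn.
  by rewrite big_distrl; apply: eq_bigr => i _; rewrite /= -mulnA -expnSr.
rewrite !shift => E.
have B0 : (0 < B)%N := leq_ltn_trans (leq0n _) (fB ord0).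
have E0 : f ord0 = g ord0.
  by move: (congr1 (modn^~ B) E); rewrite /= ![(_ + _ * B)%N]addnC !modnMDl !modn_small.
move: E; rewrite E0 => /addnI/eqP; rewrite eqn_pmul2r // => /eqP /IHn E i.
case: (unliftP ord0 i) => [j ->|-> //]; exact: E.
Qed.

Lemma mpoly_nonroot (K : numDomainType) (n : nat) (p : {mpoly K[n]}) :
  p != 0 -> exists v : 'I_n -> K, p.@[v] != 0.
Proof.
move=> p0; pose B := msize p.
(* Kronecker substitution: X_i := t^(B^i) separates monomials with exponents below B. *)
pose q : {poly K} := mmap polyC (fun i : 'I_n => 'X^(B ^ i)) p.
pose e (m : 'X_{1..n}) := (\sum_(i < n) m i * B ^ i)%N.
have mE m : mmap1 (fun i : 'I_n => 'X^(B ^ i)) m = 'X^(e m) :> {poly K}.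
  rewrite /mmap1 /e (big_morph _ (exprD 'X) (erefl : 'X^0 = 1)).
  by apply: eq_bigr => i _; rewrite -exprM mulnC.
have qE (m : 'X_{1..n}) : m \in msupp p -> q`_(e m) = p@_m.
  move=> pm; rewrite /q /mmap coef_sum (bigD1_seq m) //= mE coefCM coefXn eqxx mulr1.
  rewrite big_seq_cond big1 ?addr0 // => m' /andP[pm' m'm].
  rewrite mE coefCM coefXn; case: eqP => [E|]; last by rewrite mulr0.
  have lt (k : 'X_{1..n}) : k \in msupp p -> forall i : 'I_n, (k i < B)%N.
    move=> pk i; apply: leq_ltn_trans (msize_mdeg_lt pk).
    by rewrite mdegE (bigD1 i) //= leq_addr.
  case/negP: m'm; apply/eqP/mnmP => i.
  by rewrite (digits_inj (lt _ pm) (lt _ pm') E).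
have [|t qt] := @poly_nonroot _ q.
  apply/eqP => q0; case/negP: p0; apply/eqP/mpolyP => m; rewrite mcoeff0.
  have [pm|/memN_msupp_eq0 //] := boolP (m \in msupp p).
  by rewrite -(qE m pm) q0 coef0.
exists (fun i => t ^+ (B ^ i)); apply: contraNneq qt => <-.
by rewrite /q horner_mmap; apply/eqP/meval_eq => i; rewrite hornerXn.
Qed.

Lemma mpoly_ring_ind (R : comNzRingType) (n : nat) (P : {mpoly R[n]} -> Prop) :
  (forall c, P c%:MP) -> (forall i, P 'X_i) ->
  (forall p q, P p -> P q -> P (p + q)) -> (forall p q, P p -> P q -> P (p * q)) ->
  forall p, P p.
Proof.
move=> PC PX PD PM p; rewrite (mpolyE p); elim/big_ind: _ => [||m _].
- by rewrite -mpolyC0; apply: PC.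
- exact: PD.
rewrite -mul_mpolyC; apply: (PM) => //; rewrite mpolyXE_id.
elim/big_ind: _ => [||i _]; [by rewrite -mpolyC1; apply: PC|exact: PM|].
by elim: (m i) => [|k IH]; [rewrite expr0 -mpolyC1; apply: PC|rewrite exprS; apply: PM].
Qed.

(** The chain rule, checked on constants and variables and carried through sums and products. *)
Lemma mderiv_comp (R : comNzRingType) (n k : nat) (lq : n.-tuple {mpoly R[k]})
    (p : {mpoly R[n]}) (j : 'I_k) :
  (p \mPo lq)^`M(j) = \sum_(i < n) (p^`M(i) \mPo lq) * (tnth lq i)^`M(j).
Proof.
elim/mpoly_ring_ind: p => [c|i0|p q IHp IHq|p q IHp IHq].
- rewrite comp_mpolyC mderivC big1 // => i _.
  by rewrite mderivC comp_mpoly0 mul0r.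
- rewrite comp_mpolyXU (bigD1 i0) //= big1 ?addr0 => [|i ii0].
    rewrite -tnth_nth mderivX mnm1E eqxx scale1r.
    by rewrite -{1}[U_(i0)%MM]add0m addmK mpolyX0 comp_mpoly1 mul1r.
  by rewrite mderivX mnm1E eq_sym (negbTE ii0) scale0r comp_mpoly0 mul0r.
- rewrite comp_mpolyD mderivD IHp IHq -big_split /=; apply: eq_bigr => i _.
  by rewrite mderivD comp_mpolyD mulrDl.
rewrite rmorphM mderivM /= IHp IHq mulr_suml mulr_sumr -big_split /=.
apply: eq_bigr => i _; rewrite mderivM comp_mpolyD !rmorphM /= mulrDl.
by rewrite -!mulrA; congr (_ * _ + _); rewrite mulrC.
Qed.

Lemma msize_mderiv (R : nzRingType) (n : nat) (p : {mpoly R[n]}) (i : 'I_n) :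
  p != 0 -> (msize p^`M(i) < msize p)%N.
Proof.
move=> p0; rewrite [msize p^`M(i)]msizeE.
have: (0 < msize p)%N by rewrite lt0n msize_poly_eq0.
case E: (msize p) => [//|k] _; rewrite ltnS; apply/bigmax_leqP_seq => m mp _.
have: (m + U_(i))%MM \in msupp p.
  move: mp; rewrite !mcoeff_msupp mcoeff_mderiv; apply: contra => /eqP ->.
  by rewrite mul0rn.
by move=> /msize_mdeg_lt; rewrite mdegD mdeg1 addn1 E ltnS.
Qed.

(** In characteristic zero the coefficient of a monomial containing [X_i] survives in the derivative
    along [i], multiplied by a positive integer. *)
Lemma mpoly_const_of_deriv0 (K : numDomainType) (n : nat) (p : {mpoly K[n]}) :
  (forall i, p^`M(i) = 0) -> p = (p@_0)%:MP.
Proof.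
move=> dp; apply/mpolyP => m; rewrite mcoeffC.
have [->|/eqP m0] := eqVneq m 0%MM; first by rewrite mulr1.
rewrite mulr0; have [i mi] : exists i, m i != 0%N.
  apply/existsP; apply: contra_notT m0; rewrite negb_exists => /forallP m0.
  by apply/mnmP => i; rewrite mnm0E; apply/eqP; move: (m0 i); rewrite negbK.
have /eqP := congr1 (mcoeff (m - U_(i))) (dp i).
rewrite mcoeff_mderiv mcoeff0 submK; last first.
  by apply/mnm_lepP => j; rewrite mnm1E; case: eqP => // <-; rewrite lt0n.
by rewrite mulrn_eq0 /= => /eqP.
Qed.

(** * Generically finite fibers from an invertible Jacobian *)

Lemma exists_left_kernel (K : fieldType) (I J : finType) (a : I -> J -> K) :
  (#|J| < #|I|)%N -> exists2 u : I -> K, exists i, u i != 0 &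
    forall j, \sum_i u i * a i j = 0.
Proof.
move=> JI; pose A := \matrix_(i < #|I|, j < #|J|) a (enum_val i) (enum_val j).
have /rowV0Pn[v /sub_kermxP vA v0] : kermx A != 0.
  by rewrite -mxrank_eq0 mxrank_ker subn_eq0 -ltnNge (leq_ltn_trans (rank_leq_col A)).
exists (fun i => v 0 (enum_rank i)) => [|j].
  apply/existsP; apply: contra_neqT v0; rewrite negb_exists => /forallP v0.
  apply/rowP => k; rewrite mxE -[k]enum_valK; apply/eqP.
  by move: (v0 (enum_val k)); rewrite negbK.
have /matrixP/(_ 0 (enum_rank j)) := vA; rewrite !mxE.
rewrite (reindex _ (onW_bij _ (enum_rank_bij I))) /=.
by move=> uA; rewrite -[RHS]uA; apply: eq_bigr => i _; rewrite !mxE !enum_rankK.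
Qed.

Lemma card_bmultinom (k e : nat) : (#|{: 'X_{1..k < e.+1}}| <= e.+1 ^ k)%N.
Proof.
rewrite -[X in (X ^ _)%N]card_ord -[k in (_ ^ k)%N]card_ord -card_ffun.
pose f (m : 'X_{1..k < e.+1}) := [ffun i : 'I_k => inord (m i) : 'I_e.+1].
apply: (@leq_card _ _ f) => m1 m2 /ffunP E; apply/val_inj/mnmP => i.
have lt (m : 'X_{1..k < e.+1}) : (m i < e.+1)%N.
  by apply: leq_ltn_trans (bmdeg m); rewrite mdegE (bigD1 i) //= leq_addr.
by have := E i; rewrite !ffunE => /(congr1 val); rewrite /= !inordK.
Qed.

Lemma msize_comp_monomial (K : fieldType) (n k d B : nat)
    (f : n.-tuple {mpoly K[k]}) (m : 'X_{1..n}) :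
  (forall i, msize (tnth f i) <= d)%N -> (forall i, m i <= B)%N ->
  (msize ('X_[m] \mPo f) <= (n * (B * d)).+1)%N.
Proof.
move=> fd mB; rewrite comp_mpolyX -[n in (n * _)%N]card_ord -sum_nat_const.
have mul (p q : {mpoly K[k]}) a b : (msize p <= a.+1 -> msize q <= b.+1 ->
    msize (p * q) <= (a + b).+1)%N.
  move=> pa qb; have [->|p0] := eqVneq p 0; first by rewrite mul0r msize0.
  have [->|q0] := eqVneq q 0; first by rewrite mulr0 msize0.
  by rewrite msizeM // -ltnS prednK ?(leq_trans (leq_add pa qb)) ?addSn ?addnS //
    addn_gt0 lt0n msize_poly_eq0 p0.
elim/big_ind2: _ => [|p1 a1 p2 a2|i _]; first by rewrite msize1.
  exact: mul.
apply: (@leq_trans (m i * d).+1); last by rewrite ltnS leq_mul2r mB orbT.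
elim: (m i) => [|j IH]; first by rewrite expr0 msize1.
by rewrite exprS mulSn; apply: mul => //; rewrite ltnW // ltnS.
Qed.

Lemma algebraic_dependence (K : fieldType) (n k : nat) (f : n.-tuple {mpoly K[k]}) :
  (k < n)%N -> exists2 H : {mpoly K[n]}, H != 0 & H \mPo f = 0.
Proof.
move=> kn; pose d := (\max_(i < n) msize (tnth f i))%N.
have fd i : (msize (tnth f i) <= d)%N by apply: leq_bigmax.
(* With this value ((n d + 1) (B + 1))^k = B (B + 1)^k < (B + 1)^(k + 1) <= (B + 1)^n. *)
pose B := ((n * d).+1 ^ k)%N.
pose e := (n * (B * d))%N.
(* (B+1)^n monomials with exponents at most B are mapped into a space of dimension at
   most (e+1)^k, and e + 1 <= (n d + 1) (B + 1). *)
have count : (#|{: 'X_{1..k < e.+1}}| < #|{ffun 'I_n -> 'I_B.+1}|)%N.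
  apply: leq_ltn_trans (card_bmultinom _ _) _; rewrite card_ffun !card_ord.
  apply: (@leq_trans (B.+1 ^ k.+1)); last by rewrite leq_pexp2l.
  have expr_mono a b : (a <= b -> a ^ k <= b ^ k)%N.
    by move=> ab; case: (k) => // k'; rewrite leq_exp2r.
  apply: (@leq_ltn_trans (((n * d).+1 * B.+1) ^ k)).
    have -> : e = (n * d * B)%N by rewrite /e mulnCA mulnC.
    by apply: expr_mono; rewrite mulSn mulnS; lia.
  by rewrite expnMn expnS ltn_pmul2r ?expn_gt0.
pose mon (a : {ffun 'I_n -> 'I_B.+1}) : 'X_{1..n} := [multinom a i : nat | i < n].
have [u [a0 ua0] uker] := exists_left_kernel
  (fun a (m : 'X_{1..k < e.+1}) => ('X_[mon a] \mPo f)@_m) count.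
have monI : injective mon.
  by move=> a b /mnmP ab; apply/ffunP => i; apply/val_inj; have := ab i; rewrite !mnmE.
exists (\sum_a u a *: 'X_[mon a]).
  apply/eqP => /(congr1 (mcoeff (mon a0))); rewrite raddf_sum mcoeff0 (bigD1 a0) //=.
  rewrite big1 ?addr0 => [|a aa0]; rewrite mcoeffZ mcoeffX ?(inj_eq monI).
    by rewrite eqxx mulr1 => /eqP; rewrite (negbTE ua0).
  by rewrite (negbTE aa0) mulr0.
apply/mpolyP => m; rewrite mcoeff0 (raddf_sum (comp_mpoly f)) raddf_sum /=.
have [me|me] := ltnP (mdeg m) e.+1.
  rewrite -[RHS](uker (BMultinom me)); apply: eq_bigr => a _.
  by rewrite comp_mpolyZ mcoeffZ.
rewrite big1 // => a _; rewrite comp_mpolyZ mcoeffZ memN_msupp_eq0 ?mulr0 //.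
apply: msize_mdeg_ge; apply: leq_trans me; apply: msize_comp_monomial => // i.
by rewrite mnmE -ltnS ltn_ord.
Qed.

(** The tuple (x, F_1, ..., F_M): variable 0 of a relation stands for the coordinate, the others for
    the components of the map. *)
Definition adjoin_coord (R : comNzRingType) (k M : nat) (x : {mpoly R[k]})
    (F : 'I_M -> {mpoly R[k]}) : M.+1.-tuple {mpoly R[k]} :=
  [tuple if unlift ord0 i is Some l then F l else x | i < M.+1].

Lemma tnth_adjoin0 (R : comNzRingType) (k M : nat) x (F : 'I_M -> {mpoly R[k]}) :
  tnth (adjoin_coord x F) ord0 = x.
Proof. by rewrite tnth_mktuple unlift_none. Qed.

Lemma tnth_adjoin_lift (R : comNzRingType) (k M : nat) x (F : 'I_M -> {mpoly R[k]}) i :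
  tnth (adjoin_coord x F) (lift ord0 i) = F i.
Proof. by rewrite tnth_mktuple liftK. Qed.

Definition tnth_adjoin := (tnth_adjoin0, tnth_adjoin_lift).

(* A relation of minimal degree works: if all its derivatives vanished after substitution,
   they would be relations of smaller degree. *)
Lemma separable_relation (K : numFieldType) (M : nat) (F : 'I_M -> {mpoly K[M]})
    (x : {mpoly K[M]}) :
  \det (\matrix_(i, j) (F i)^`M(j)) != 0 ->
  exists H : {mpoly K[M.+1]}, H \mPo adjoin_coord x F = 0 /\
    H^`M(ord0) \mPo adjoin_coord x F != 0.
Proof.
move=> detJ; have [H H0 HF] := algebraic_dependence (adjoin_coord x F) (ltnSn M).
have [k] := ubnP (msize H); elim: k H H0 HF => // k IH H H0 HF Hk.
have [d0H|d0H] := eqVneq (H^`M(ord0) \mPo adjoin_coord x F) 0; last by exists H.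
have dH i : H^`M(i) \mPo adjoin_coord x F = 0.
  case: (unliftP ord0 i) => [l ->|-> //].
  pose g := \row_(i < M) (H^`M(lift ord0 i) \mPo adjoin_coord x F).
  pose J := \matrix_(i, j) (F i)^`M(j).
  have gJ : g *m J = 0.
    apply/rowP => j; rewrite !mxE.
    have := mderiv_comp (adjoin_coord x F) H j.
    rewrite HF mderiv0 big_ord_recl d0H mul0r add0r => E; rewrite [RHS]E.
    by apply: eq_bigr => m _; rewrite !mxE tnth_adjoin.
  (* The adjugate replaces an inverse over the polynomial ring: it yields [\det J] times each entry
     of [g], and the nonzero determinant cancels. *)
  have : g *m J *m \adj J = 0 by rewrite gJ mul0mx.
  rewrite -mulmxA mul_mx_adj mul_mx_scalar => /rowP/(_ l).
  by rewrite !mxE => /eqP; rewrite mulf_eq0 (negbTE detJ) /= => /eqP.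
have [i di|d0] := pickP (fun i => H^`M(i) != 0).
  apply: (IH _ di (dH i)); apply: leq_trans (msize_mderiv i H0) _.
  by rewrite -ltnS.
have HC : H = (H@_0)%:MP.
  by apply: mpoly_const_of_deriv0 => i; apply/eqP; move: (d0 i) => /negbFE.
move: HF; rewrite {1}HC comp_mpolyC => /eqP; rewrite mpolyC_eq0 => /eqP c0.
by move: H0; rewrite HC c0 mpolyC0 eqxx.
Qed.

Lemma generic_fiber_roots (K : numFieldType) (M : nat) (F : 'I_M -> {mpoly K[M]})
    (y0 : 'I_M -> K) :
  (forall i j, (F i)^`M(j).@[y0] = (i == j)%:R) ->
  exists2 P : {mpoly K[M]}, P != 0 & forall v, P.@[v] != 0 ->
    exists r : 'I_M -> {poly K}, (forall j, r j != 0) /\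
      forall w, (forall i, (F i).@[w] = (F i).@[v]) -> forall j, root (r j) (w j).
Proof.
move=> J1; have detJ : \det (\matrix_(i, j) (F i)^`M(j)) != 0.
  apply/eqP => /(congr1 (meval y0)); rewrite -det_map_mx meval0.
  rewrite (_ : map_mx _ _ = 1%:M) ?det1; first by apply/eqP/oner_neq0.
  by apply/matrixP => i j; rewrite !mxE -J1.
have /fin_all_exists[H HP] j := separable_relation 'X_j detJ.
exists (\prod_j ((H j)^`M(ord0) \mPo adjoin_coord 'X_j F)).
  by apply/prodf_neq0 => j _; have [] := HP j.
move=> v; rewrite rmorph_prod => /prodf_neq0 Pv.
pose c : 'I_M -> {mpoly K[1]} := fun i => ((F i).@[v])%:MP.
(* This is H_j(z, F(v)), kept as a polynomial in one variable of [mpoly] so that the chain rule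
   applies to it. *)
pose h j := H j \mPo adjoin_coord 'X_ord0 c.
exists (fun j => mmap polyC (fun=> 'X) (h j)); split=> [j|w Fw j].
  have [|z hz] := @mpoly_nonroot _ _ (h j).
    (* If [h j] vanished, so would its derivative at [v j], which by the chain rule is the value at
       [v] of the factor of [P] with index [j]. *)
    apply: contraTneq (Pv j isT) => h0; rewrite negbK.
    have := congr1 (meval (fun=> v j)) (mderiv_comp (adjoin_coord 'X_ord0 c) (H j) ord0).
    rewrite -/(h j) h0 mderiv0 meval0 big_ord_recl big1 => [|i _]; last first.
      by rewrite tnth_adjoin mderivC mulr0.
    rewrite addr0 tnth_adjoin mderivX mnm1E eqxx scale1r -{2}[U_(ord0)%MM]add0m addmK.
    rewrite mpolyX0 mulr1 !comp_mpoly_meval => E; apply/eqP; rewrite [RHS]E.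
    rewrite [LHS]comp_mpoly_meval; apply: meval_eq => i.
    case: (unliftP ord0 i) => [l|] ->; rewrite !tnth_adjoin ?mevalXU //.
    by rewrite mevalC.
  apply: contraNneq hz => r0; have := horner_mmap (fun=> 'X) (h j) (z ord0).
  rewrite r0 horner0 => E; rewrite [_ == _](_ : _ = true) //; apply/eqP.
  rewrite E; apply: meval_eq => i; by rewrite hornerX ord1.
rewrite /root horner_mmap comp_mpoly_meval.
have := congr1 (meval w) (HP j).1; rewrite comp_mpoly_meval meval0 => E.
apply/eqP; rewrite -[RHS]E; apply: meval_eq => i.
case: (unliftP ord0 i) => [l|] ->; rewrite !tnth_adjoin ?mevalXU ?hornerX //.
by rewrite mevalC Fw.
Qed.

(** * General parameters and sums of subspaces *)

Section Cofinite.
Variable K : numFieldType.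
Implicit Types Q : K -> Prop.

Definition cofinite Q := exists2 p : {poly K}, p != 0 & forall t, p.[t] != 0 -> Q t.

Lemma cofiniteT Q : (forall t, Q t) -> cofinite Q.
Proof. by move=> QT; exists 1 => [|t _]; [apply: oner_neq0|apply: QT]. Qed.

Lemma cofiniteW Q Q' : (forall t, Q t -> Q' t) -> cofinite Q -> cofinite Q'.
Proof. by move=> QQ' [p p0 pQ]; exists p => // t /pQ/QQ'. Qed.

Lemma cofiniteI Q Q' : cofinite Q -> cofinite Q' -> cofinite (fun t => Q t /\ Q' t).
Proof.
move=> [p p0 pQ] [q q0 qQ']; exists (p * q); first by rewrite mulf_neq0.
by move=> t; rewrite hornerM mulf_eq0 negb_or => /andP[/pQ ? /qQ' ?].
Qed.

Lemma cofinite_flip Q : cofinite Q -> cofinite (fun t => Q (1 - t)).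
Proof.
move=> [p p0 pQ]; exists (p \Po (1 - 'X)).
  rewrite -size_poly_eq0 size_comp_poly2 ?size_poly_eq0 //.
  by rewrite -opprB size_polyN -polyC1 size_XsubC.
by move=> t; rewrite horner_comp !hornerE => /pQ.
Qed.

Lemma cofinite_ex Q : cofinite Q -> exists t, Q t.
Proof. by move=> [p /poly_nonroot[t pt] pQ]; exists t; apply: pQ. Qed.

End Cofinite.

Section Curves.
Variables (K : numFieldType) (V : vectType K).

(** Polynomial dependence on t is expressed through linear functionals, so that no basis has to be
    fixed. *)
Definition poly_curve (c : K -> V) :=
  forall f : V -> K, scalar f -> exists p : {poly K}, forall t, f (c t) = p.[t].

(** A basis of [U 0] is moved along polynomial curves. The determinant of its coordinates is a
    polynomial in t with value 1 at t = 0, and the moved vectors stay independent wherever it does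
    not vanish. *)
Lemma dim_lower_semicont (U : K -> {vspace V}) :
  (forall v, v \in U 0 -> exists c, [/\ poly_curve c, c 0 = v & forall t, c t \in U t]) ->
  cofinite (fun t => (\dim (U 0%R) <= \dim (U t))%N).
Proof.
move=> lift; set k := \dim (U 0); pose b := vbasis (U 0).
have /fin_all_exists[c cP] (i : 'I_k) := lift _ (vbasis_mem (mem_tnth i b)).
have /fin_all_exists[p pP] (i : 'I_k) : exists p : 'I_k -> {poly K},
    forall j t, coord b j (c i t) = (p j).[t].
  have [cpoly _ _] := cP i; apply: (@fin_all_exists _ _ (fun j p => forall t, _ = p.[t])) => j.
  by apply: cpoly => a u v; rewrite linearP.
pose A := \matrix_(i, j) p i j.
have AE t : map_mx (horner_eval t) A = \matrix_(i, j) coord b j (c i t).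
  by apply/matrixP => i j; rewrite !mxE pP.
have detE t : (\det A).[t] = \det (\matrix_(i, j) coord b j (c i t)).
  by rewrite -AE det_map_mx.
exists (\det A) => [|t].
  apply/eqP => A0; have := detE 0; rewrite A0 horner0.
  rewrite (_ : (\matrix_(i, j) _) = 1%:M) ?det1; first by move/esym/eqP; rewrite oner_eq0.
  apply/matrixP => i j; have [_ ci _] := cP i; rewrite !mxE ci (tnth_nth 0) coord_free 1?eq_sym //.
  exact: (basis_free (vbasisP _)).
rewrite detE => detA; pose X := [tuple c i t | i < k].
have freeX : free X.
  apply/freeP => a aX i.
  pose row := \row_i a i.
  have : row *m (\matrix_(i, j) coord b j (c i t)) = 0.
    apply/rowP => j; rewrite !mxE; have := congr1 (coord b j) aX.
    rewrite linear0 linear_sum => E; rewrite -[RHS]E; apply: eq_bigr => l _.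
    by rewrite !mxE linearZ /= (nth_map i) ?size_enum_ord // nth_ord_enum.
  move/(congr1 (mulmx^~ (invmx (\matrix_(i, j) coord b j (c i t))))).
  rewrite mulmxK ?unitmxE ?unitfE // mul0mx => /rowP/(_ i).
  by rewrite !mxE.
have := freeX; rewrite /free => /eqP; rewrite size_tuple => <-.
apply/dimvS/span_subvP => v /mapP[i _ ->].
by have [_ _] := cP i.
Qed.

End Curves.

Section GenericSums.
Variables (K : numFieldType) (V : vectType K) (S : lmodType K) (I : eqType).
Variable T : I -> S -> {vspace V}.
Hypothesis T_lift : forall i q0 q1 v, v \in T i q0 ->
  exists c, [/\ poly_curve c, c 0 = v & forall t, c t \in T i (q0 + t *: (q1 - q0))].

Implicit Types (x y : nat -> S) (L : seq (I * nat)) (s : seq I).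

Definition line x y (t : K) : nat -> S := fun j => x j + t *: (y j - x j).

Lemma line0 x y : line x y 0 = x.
Proof. by apply/funext => j; rewrite /line scale0r addr0. Qed.

Lemma line_flip x y t : line x y (1 - t) = line y x t.
Proof.
apply/funext => j; rewrite /line scalerBl scale1r addrA subrKC.
by rewrite -scalerN opprB.
Qed.

(* Replaces Zariski openness: a set is open if it contains cofinitely many points of
   every line through each of its points.  Nonempty open sets meet. *)
Definition line_open (Q : (nat -> S) -> Prop) :=
  forall x y, Q x -> cofinite (fun t => Q (line x y t)).

Lemma line_openI Q Q' : line_open Q -> line_open Q' -> line_open (fun x => Q x /\ Q' x).
Proof. by move=> oQ oQ' x y [Qx Qx']; apply: cofiniteI; [apply: oQ|apply: oQ']. Qed.

(** On the line joining a point of [Q] to a point of [Q'], each condition holds at cofinitely many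
    points, so some point satisfies both. *)
Lemma line_open_meet Q Q' : line_open Q -> line_open Q' ->
  (exists x, Q x) -> (exists x, Q' x) -> exists x, Q x /\ Q' x.
Proof.
move=> oQ oQ' [x Qx] [y Qy].
have /cofinite_flip coQ' := oQ' _ x Qy.
have [t [Qt Qt']] := cofinite_ex (cofiniteI (oQ _ y Qx) coQ').
by exists (line x y t); split=> //; move: Qt'; rewrite line_flip.
Qed.

(* In a pair (i, j), i is the type of the summand and j the index of its parameter. *)
Definition sumT x L := (\sum_(p <- L) T p.1 (x p.2))%VS.

Lemma sumT_cons x p L : sumT x (p :: L) = (T p.1 (x p.2) + sumT x L)%VS.
Proof. exact: big_cons. Qed.

Lemma sumT_eq x y L : {in [seq p.2 | p <- L], x =1 y} -> sumT x L = sumT y L.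
Proof.
move=> xy; rewrite /sumT; apply: eq_big_seq => p pL.
by rewrite xy // map_f.
Qed.

Lemma sumT_subset x L L' : {subset L <= L'} -> (sumT x L <= sumT x L')%VS.
Proof.
have sup p : p \in L' -> (T p.1 (x p.2) <= sumT x L')%VS.
  by move=> pL; rewrite /sumT (big_rem p pL) addvSl.
elim: L => [|p L IH] LL'; first by rewrite /sumT big_nil sub0v.
rewrite sumT_cons subv_add sup ?LL' ?mem_head // IH // => p' p'L.
by rewrite LL' // in_cons p'L orbT.
Qed.

Lemma sumT_lift x y L v : v \in sumT x L ->
  exists c, [/\ poly_curve c, c 0 = v & forall t, c t \in sumT (line x y t) L].
Proof.
elim: L v => [|p L IH] v.
  rewrite /sumT big_nil memv0 => /eqP ->; exists (fun=> 0); split=> // [f fl|t].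
    exists 0 => t; rewrite horner0; have := fl 1 0 0.
    rewrite scaler0 addr0 mul1r => f0.
    by apply: (addrI (f 0)); rewrite addr0.
  exact: mem0v.
rewrite sumT_cons => /memv_addP[u uT [w /IH[c [cp c0 cL]] ->]].
have [d [dp d0 dT]] := T_lift (y p.2) uT.
exists (fun t => d t + c t); split=> [f fl|| t]; last 2 first.
- by rewrite d0 c0.
- by rewrite sumT_cons memv_add.
have [a aE] := dp f fl; have [b bE] := cp f fl.
exists (a + b) => t; rewrite hornerD -aE -bE.
by have := fl 1 (d t) (c t); rewrite scale1r mul1r.
Qed.

(** The dimension at general parameters, obtained as the largest one that occurs; semicontinuity
    shows later that it occurs on a line-open set. *)
Definition gdim L : nat :=
  \max_(d < (\dim {:V}).+1 | `[< exists x, \dim (sumT x L) = d >]) d.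

Lemma gdim_ub x L : (\dim (sumT x L) <= gdim L)%N.
Proof.
have lt : (\dim (sumT x L) < (\dim {:V}).+1)%N by rewrite ltnS dimvS ?subvf.
rewrite -[leqLHS]/(val (Ordinal lt)) /gdim.
by apply: (@leq_bigmax_cond _ _ (fun d : 'I_(\dim {:V}).+1 => val d)); apply/asboolP; exists x.
Qed.

Lemma gdim_attained L : exists x, \dim (sumT x L) = gdim L.
Proof.
have lt : (\dim (sumT (fun=> 0%R) L) < (\dim {:V}).+1)%N by rewrite ltnS dimvS ?subvf.
have [|d /asboolP[x xd] dmax] := @eq_bigmax_cond _
  [pred d : 'I_(\dim {:V}).+1 | `[< exists x, \dim (sumT x L) = d >]] (fun d => val d).
  by apply/card_gt0P; exists (Ordinal lt); apply/asboolP; exists (fun=> 0%R).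
by exists x; rewrite xd.
Qed.

(** Since the indices in [L'] are distinct, its parameters can be chosen freely and can imitate any
    choice for [L], position by position. *)
Lemma gdim_le_types L L' : unzip1 L = unzip1 L' -> uniq (unzip2 L') ->
  (gdim L <= gdim L')%N.
Proof.
move=> types uL'; have [x <-] := gdim_attained L.
pose y j := x (nth 0%N (unzip2 L) (index j (unzip2 L'))).
suff -> : sumT x L = sumT y L' by apply: gdim_ub.
have sz : size L = size L' by have := congr1 size types; rewrite !size_map.
case: L sz types @y => [|p0 L1] sz types y.
  by move: sz => /esym/size0nil ->; rewrite /sumT !big_nil.
set L := p0 :: L1 in sz types y *.
rewrite /sumT (big_nth p0) [RHS](big_nth p0) sz.
rewrite !big_nat; apply: eq_bigr => i /andP[_ iL].
have -> : (nth p0 L i).1 = (nth p0 L' i).1.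
  by have := congr1 (fun s => nth p0.1 s i) types; rewrite !(nth_map p0) ?sz.
congr (T _ _); rewrite /y; have <- : nth 0%N (unzip2 L') i = (nth p0 L' i).2.
  by rewrite (nth_map p0).
by rewrite index_uniq ?size_map // (nth_map p0) ?sz.
Qed.

Definition tdim s := gdim (zip s (iota 0 (size s))).

Lemma gdimE L : uniq (unzip2 L) -> gdim L = tdim (unzip1 L).
Proof.
move=> uL.
apply/eqP; rewrite eqn_leq !gdim_le_types //.
- by rewrite unzip1_zip // size_iota.
- by rewrite unzip1_zip // size_iota.
- by rewrite unzip2_zip ?iota_uniq // size_iota.
Qed.

Definition generic_for (Ls : seq (seq (I * nat))) x :=
  forall L, L \in Ls -> \dim (sumT x L) = gdim L.

Lemma generic_for_cons L Ls x :
  generic_for (L :: Ls) x <-> \dim (sumT x L) = gdim L /\ generic_for Ls x.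
Proof.
split=> [gen|[genL gen] L']; last by rewrite in_cons => /predU1P[->|/gen].
by split=> [|L' L'Ls]; apply: gen; rewrite in_cons ?eqxx ?L'Ls ?orbT.
Qed.

Lemma generic_for_cat Ls Ls' x :
  generic_for (Ls ++ Ls') x <-> generic_for Ls x /\ generic_for Ls' x.
Proof.
split=> [gen|[gen gen'] L]; last by rewrite mem_cat => /orP[/gen|/gen'].
by split=> L LLs; apply: gen; rewrite mem_cat LLs ?orbT.
Qed.

Lemma line_open_generic Ls : line_open (generic_for Ls).
Proof.
move=> x y; elim: Ls => [|L Ls IH] gen; first by apply: cofiniteT.
move: gen => /generic_for_cons[genL /IH].
move/(cofiniteI (dim_lower_semicont (U := fun t => sumT (line x y t) L) _)) => cof.
apply: cofiniteW (cof _) => [t [le gen]|v].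
  apply/generic_for_cons; split=> //; apply/eqP.
  by rewrite eqn_leq gdim_ub -genL -[x in sumT x](line0 x y).
by rewrite line0; apply: sumT_lift.
Qed.

Lemma generic_for_ex Ls : exists x, generic_for Ls x.
Proof.
elim: Ls => [|L Ls IH]; first by exists (fun=> 0).
have := line_open_meet (@line_open_generic [:: L]) (@line_open_generic Ls).
case=> // [|x [/generic_for_cons[gL _] gLs]].
  have [x xL] := gdim_attained L; exists x.
  by move=> L'; rewrite inE => /eqP ->.
by exists x; apply/generic_for_cons.
Qed.

End GenericSums.

(** As long as some [f g] lies outside the span, adjoining it raises the dimension, which is
    bounded. *)
Lemma span_family_finite (K : fieldType) (V : vectType K) (G : Type) (f : G -> V) :
  exists gs : seq G, forall g, f g \in <<[seq f g | g <- gs]>>%VS.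
Proof.
suff: forall k gs, (\dim {:V} - \dim <<[seq f g | g <- gs]>> < k)%N ->
    exists gs : seq G, forall g, f g \in <<[seq f g | g <- gs]>>%VS.
  by move=> fin; apply: (fin _ [::] (ltnSn _)).
elim=> // k IH gs lt.
have [all_in|/existsNP[g /negP fg]] := pselect (forall g, f g \in <<[seq f g | g <- gs]>>%VS).
  by exists gs.
apply: (IH (g :: gs)); rewrite /= span_cons.
have : (\dim <<[seq f g | g <- gs]>> < \dim (<[f g]> + <<[seq f g | g <- gs]>>))%N.
  rewrite ltnNge; apply: contra fg => le.
  have /eqP -> : (<<[seq f g | g <- gs]>> == <[f g]> + <<[seq f g | g <- gs]>>)%VS.
    by rewrite eqEdim addvSr.
  by rewrite memvE addvSl.
have : (\dim (<[f g]> + <<[seq f g | g <- gs]>>) <= \dim {:V})%N by rewrite dimvS ?subvf.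
move: lt; lia.
Qed.

(** * Independence of general summands by descent on the increment of the dimension *)

Section Descent.
Variables (K : numFieldType) (V : vectType K) (S : lmodType K) (I : eqType).
Variables (T : I -> S -> {vspace V}) (N : nat).
Hypothesis T_lift : forall i q0 q1 v, v \in T i q0 ->
  exists c, [/\ poly_curve c, c 0 = v & forall t, c t \in T i (q0 + t *: (q1 - q0))].
Hypothesis T_dim : forall i q, (\dim (T i q) <= N)%N.
Hypothesis T_gen : forall i, exists q, \dim (T i q) = N.
Variables (G : Type) (gS : G -> S -> S) (gV : G -> 'End(V)).
Hypothesis gV_inj : forall g, lker (gV g) = 0%VS.
Hypothesis T_equivariant : forall g i q, T i (gS g q) = (gV g @: T i q)%VS.
Hypothesis gV_irreducible : forall e (U : {vspace V}), e != 0 ->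
  (forall g, gV g e \in U) -> U = fullv.

Implicit Types (x y : nat -> S) (L : seq (I * nat)) (s : seq I).
Local Notation sumT := (sumT T).
Local Notation gdim := (gdim T).
Local Notation tdim := (tdim T).
Local Notation generic_for := (generic_for T).

Lemma gdim1 i j : gdim [:: (i, j)] = N.
Proof.
apply/eqP; rewrite eqn_leq; apply/andP; split.
  by have [x <-] := gdim_attained T [:: (i, j)]; rewrite sumT_cons /sumT big_nil addv0.
have [q <-] := T_gen i; have := gdim_ub T (fun=> q) [:: (i, j)].
by rewrite sumT_cons /sumT big_nil addv0.
Qed.

(** Index 0 is reserved for the extra summand of type [i]; the lists [L] it is used with avoid this
    index. *)
Definition capT i x L := (T i (x 0%N) :&: sumT x L)%VS.

Lemma dim_capT i x L : uniq (0%N :: unzip2 L) ->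
  generic_for [:: [:: (i, 0%N)]; L; (i, 0%N) :: L] x ->
  (\dim (capT i x L) + tdim (i :: unzip1 L) = N + tdim (unzip1 L))%N.
Proof.
move=> uL gen; have uL' : uniq (unzip2 L) by case/andP: uL.
have := dimv_sum_cap (T i (x 0%N)) (sumT x L).
have -> : (T i (x 0%N) + sumT x L)%VS = sumT x ((i, 0%N) :: L) by rewrite sumT_cons.
have -> : \dim (T i (x 0%N)) = N.
  rewrite -(gdim1 i 0) -gen ?mem_head // sumT_cons /sumT big_nil addv0 //.
rewrite (gen L) ?inE ?eqxx ?orbT // (gen (_ :: _)) ?inE ?eqxx ?orbT //.
by rewrite !gdimE // addnC.
Qed.

(* Adding a summand of any type does not lower the increment contributed by type i. *)
Section Stationary.
Variables (i : I) (s : seq I).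
Hypothesis stationary : forall j,
  (tdim [:: i, j & s] + tdim s = tdim (i :: s) + tdim (j :: s))%N.

(** Both intersections are contained in the one for the longer list [M], which has both [(j, a)] and
    [(j, b)]. Stationarity makes all three dimensions equal at general parameters. *)
Lemma capT_swap L1 L2 j a b : unzip1 (L1 ++ (j, a) :: L2) = s ->
  uniq [:: 0%N, b & unzip2 (L1 ++ (j, a) :: L2)] ->
  exists Ls, forall x, generic_for Ls x ->
    capT i x (L1 ++ (j, a) :: L2) = capT i x (L1 ++ (j, b) :: L2).
Proof.
set L := L1 ++ (j, a) :: L2; set L' := L1 ++ (j, b) :: L2 => sL uL.
pose M := (j, b) :: L.
have sL' : unzip1 L' = s by rewrite -sL /L /L' /unzip1 !map_cat.
have uL' : uniq (0%N :: unzip2 L').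
  move: uL; have : perm_eq [:: 0%N, b & unzip2 L] ((0%N :: unzip2 L') ++ [:: a]).
    by apply/permP => P; rewrite /= /L /L' /unzip2 !map_cat !count_cat /=; lia.
  by move/perm_uniq => -> ; rewrite cat_uniq => /and3P[].
have uM : uniq (0%N :: unzip2 M) by [].
have uL0 : uniq (0%N :: unzip2 L).
  by move: uL; rewrite /= inE negb_or => /and3P[/andP[_ ->] _ ->].
pose f L0 := [:: [:: (i, 0%N)]; L0; (i, 0%N) :: L0].
exists (f L ++ f L' ++ f M) => x /generic_for_cat[gL /generic_for_cat[gL' gM]].
have dL := dim_capT uL0 gL; have dL' := dim_capT uL' gL'.
have dM := dim_capT uM gM; have st := stationary j.
rewrite sL in dL; rewrite sL' in dL'; rewrite /= sL in dM.
have capS L0 : {subset L0 <= M} -> (capT i x L0 <= capT i x M)%VS.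
  by move=> sub; apply: capvS (subvv _) (sumT_subset _ _ sub).
have LM : {subset L <= M} by move=> p pL; rewrite in_cons pL orbT.
have L'M : {subset L' <= M}.
  by move=> p; rewrite /M /L /L' !(mem_cat, in_cons) => /or3P[] -> ; rewrite ?orbT.
have eqM L0 : {subset L0 <= M} -> (\dim (capT i x M) <= \dim (capT i x L0))%N ->
    capT i x L0 = capT i x M.
  by move=> /capS sub le; apply/eqP; rewrite eqEdim sub.
by rewrite (eqM L) 1?(eqM L') //; move: dL dL' dM st; clear; lia.
Qed.

(** The indices [a2] are exchanged for [b2] one at a time; [L1] collects the summands already
    exchanged. *)
Lemma capT_chain s2 L1 a2 b2 : size a2 = size s2 -> size b2 = size s2 ->
  unzip1 L1 ++ s2 = s -> uniq (0%N :: unzip2 L1 ++ a2 ++ b2) ->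
  exists Ls, forall x, generic_for Ls x ->
    capT i x (L1 ++ zip s2 a2) = capT i x (L1 ++ zip s2 b2).
Proof.
elim: s2 L1 a2 b2 => [|j s2 IH] L1 [|a a2] [|b b2] //=; first by exists [::].
move=> [sza] [szb] sE uLab.
have [||Ls1 swap] := @capT_swap L1 (zip s2 a2) j a b.
- by rewrite /unzip1 map_cat /= -/(unzip1 _) -/(unzip1 _) unzip1_zip ?sza.
- move: uLab; rewrite -cons_uniq.
  have : perm_eq (0%N :: unzip2 L1 ++ a :: a2 ++ b :: b2)
      ([:: 0%N, b & unzip2 (L1 ++ (j, a) :: zip s2 a2)] ++ b2).
    rewrite /unzip2 map_cat /= -/(unzip2 _) -/(unzip2 _) unzip2_zip ?sza //.
    by apply/permP => P; rewrite /= !(count_cat, =^~ catA) /= !count_cat /=; lia.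
  by move/perm_uniq => ->; rewrite cat_uniq => /and3P[].
have [||Ls2 chain] := IH (rcons L1 (j, b)) a2 b2 sza szb.
- by rewrite /unzip1 map_rcons cat_rcons.
- move: uLab; rewrite -cons_uniq.
  have : perm_eq (0%N :: unzip2 L1 ++ a :: a2 ++ b :: b2)
      ((0%N :: unzip2 (rcons L1 (j, b)) ++ a2 ++ b2) ++ [:: a]).
    rewrite /unzip2 map_rcons -cats1.
    by apply/permP => P; rewrite /= !count_cat /= !count_cat /=; lia.
  by move/perm_uniq => ->; rewrite cat_uniq => /and3P[].
exists (Ls1 ++ Ls2) => x /generic_for_cat[/swap -> /chain].
by rewrite !cat_rcons.
Qed.

Lemma stationary_full : (tdim (i :: s) < tdim s + N)%N -> tdim s = \dim {:V}.
Proof.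
move=> defect; pose k := size s.
pose a := iota 1 k; pose b := iota k.+1 k.
have uab : uniq (0%N :: unzip2 ([::] : seq (I * nat)) ++ a ++ b).
  by rewrite /= -iotaD iota_uniq mem_iota.
have [||Ls chain] := capT_chain _ _ (erefl : unzip1 [::] ++ s = s) uab.
- by rewrite size_iota.
- by rewrite size_iota.
pose La := zip s a; pose Lb := zip s b.
have La1 : unzip1 La = s by rewrite unzip1_zip ?size_iota.
have Lb1 : unzip1 Lb = s by rewrite unzip1_zip ?size_iota.
have La2 : unzip2 La = a by rewrite unzip2_zip ?size_iota.
have Lb2 : unzip2 Lb = b by rewrite unzip2_zip ?size_iota.
have [x gen] := generic_for_ex T_lift (Ls ++ [:: [:: (i, 0%N)]; La; (i, 0%N) :: La]).
case/generic_for_cat: gen => genLs genLa.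
have uLa : uniq (0%N :: unzip2 La) by rewrite La2 /= iota_uniq mem_iota.
have /eqP := dim_capT uLa genLa; rewrite La1 => dimcap.
(* An increment smaller than [N] means that the new summand meets the old sum nontrivially. *)
have : capT i x La != 0%VS by rewrite -dimv_eq0; move: defect dimcap; lia.
rewrite -vpick0; set e := vpick _ => e0.
have eL : e \in capT i x La by apply: memv_pick.
(* The parameters x 0 .. x k, moved by g, followed by those of y: the vector gV g e depends
   only on the former, yet lies in the sum of the tangent spaces at the latter. *)
pose merge g y : nat -> S := fun j => if (j <= k)%N then gS g (x j) else y j.
have sumT_gS g L : sumT (fun j => gS g (x j)) L = (gV g @: sumT x L)%VS.
  elim: L => [|p L IH]; first by rewrite /sumT !big_nil limg0.
  by rewrite !sumT_cons IH T_equivariant limgD.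
have e_in g y : generic_for Ls (merge g y) -> gV g e \in sumT y Lb.
  move=> gen; have := chain _ gen; rewrite /= -/La -/Lb => capE.
  have : gV g e \in capT i (merge g y) La.
    have -> : capT i (merge g y) La = capT i (fun j => gS g (x j)) La.
      rewrite /capT /merge /=; congr (_ :&: _)%VS; apply: sumT_eq => j.
      by rewrite -/(unzip2 La) La2 mem_iota add1n ltnS => /andP[_ ->].
    move: eL; rewrite /capT sumT_gS T_equivariant !memv_cap => /andP[e1 e2].
    by rewrite !memv_img.
  rewrite capE memv_cap => /andP[_]; rewrite (@sumT_eq _ _ _ _ _ _ y) // => j.
  rewrite -/(unzip2 Lb) Lb2 mem_iota /merge => /andP[kj _].
  by rewrite leqNgt kj.
(* Genericity can be imposed for finitely many [g] at once, and finitely many already span the orbit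
   of [e]. *)
have [gs gsE] := span_family_finite (fun g => gV g e).
pose Q hs y := foldr (fun g P => generic_for Ls (merge g y) /\ P) True hs.
have merge_open g : line_open (fun y => generic_for Ls (merge g y)).
  move=> y z gen; have := line_open_generic T_lift (merge g z) gen.
  apply: cofiniteW => t; rewrite (_ : line _ _ t = merge g (line y z t)) //.
  by apply/funext => j; rewrite /line /merge; case: ifP; rewrite // subrr scaler0 addr0.
have Qopen hs : line_open (Q hs).
  by elim: hs => [|g hs IH] /=; [move=> y z _; apply: cofiniteT|apply: line_openI].
have [y Qy] : exists y, Q gs y.
  elim: (gs) => [|g hs IH] /=; first by exists x.
  (* The condition for [g] is satisfiable: if the second half is also moved by [g], the merged
     sequence is the translate of [x], and the injective [gV g] preserves dimensions. *)
  apply: line_open_meet (merge_open g) (Qopen hs) _ IH; exists (fun j => gS g (x j)).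
  move=> L LLs; rewrite (_ : merge _ _ = fun j => gS g (x j)); last first.
    by apply/funext => j; rewrite /merge if_same.
  by rewrite sumT_gS limg_dim_eq ?gV_inj ?capv0 //; apply: genLs.
have : (<<[seq gV g e | g <- gs]>> <= sumT y Lb)%VS.
  elim: (gs) Qy => [|g hs IH] /=; first by rewrite span_nil sub0v.
  by move=> [/e_in eg /IH]; rewrite span_cons subv_add -memvE eg.
rewrite (gV_irreducible e0 gsE) => full.
have uLb : uniq (unzip2 Lb) by rewrite Lb2 iota_uniq.
apply/eqP; rewrite eqn_leq -{2}Lb1 -gdimE //.
rewrite (leq_trans (dimvS full)) ?gdim_ub // andbT.
have [z zE] := gdim_attained T (zip s (iota 0 (size s))).
by rewrite -[tdim s]zE dimvS ?subvf.
Qed.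

End Stationary.

(** With W the sum for [s], the dimension formula is applied to T_i + W and T_j + W, whose
    intersection contains W. *)
Lemma tdim_submodular i j s :
  (tdim [:: i, j & s] + tdim s <= tdim (i :: s) + tdim (j :: s))%N.
Proof.
pose L := zip s (iota 2 (size s)).
have L1 : unzip1 L = s by rewrite unzip1_zip ?size_iota.
have L2 : unzip2 L = iota 2 (size s) by rewrite unzip2_zip ?size_iota.
pose pi := (i, 0%N); pose pj := (j, 1%N).
have uL : uniq [:: 0%N, 1%N & unzip2 L].
  by rewrite L2 /= iota_uniq !inE !mem_iota.
have [x gen] := generic_for_ex T_lift [:: L; pi :: L; pj :: L; [:: pi, pj & L]].
have /and3P[n0 n1 uL0] : [&& 0%N \notin 1%N :: unzip2 L, 1%N \notin unzip2 L & uniq (unzip2 L)].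
  by [].
have n0' : 0%N \notin unzip2 L by move: n0; rewrite inE negb_or => /andP[].
rewrite -L1 -(gdimE T (L := [:: pi, pj & L])) // -(gdimE T (L := pi :: L)) /= ?n0' //.
rewrite -(gdimE T (L := pj :: L)) /= ?n1 // -gdimE //.
rewrite -!gen ?inE ?eqxx ?orbT // !sumT_cons.
have := dimv_sum_cap (T i (x 0%N) + sumT x L)%VS (T j (x 1%N) + sumT x L)%VS.
have -> : (T i (x 0%N) + sumT x L + (T j (x 1%N) + sumT x L) =
    T i (x 0%N) + (T j (x 1%N) + sumT x L))%VS.
  by rewrite -addvA [(sumT x L + _)%VS]addvC -(addvA (T j _)) addvv.
have : (\dim (sumT x L) <= \dim ((T i (x 0%N) + sumT x L) :&: (T j (x 1%N) + sumT x L)))%N.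
  by rewrite dimvS // subv_cap !addvSr.
rewrite /=; lia.
Qed.

Lemma tdim_mono i s : (tdim s <= tdim (i :: s))%N.
Proof.
pose L := zip s (iota 1 (size s)).
have L1 : unzip1 L = s by rewrite unzip1_zip ?size_iota.
have L2 : unzip2 L = iota 1 (size s) by rewrite unzip2_zip ?size_iota.
have uL : uniq (0%N :: unzip2 L) by rewrite L2 /= iota_uniq mem_iota.
have [x xL] := gdim_attained T L.
rewrite -{1}L1 -gdimE; last by case/andP: uL.
rewrite -xL -L1 -(gdimE T (L := (i, 0%N) :: L)) //.
by apply: leq_trans (gdim_ub T x _); rewrite dimvS // sumT_cons addvSr.
Qed.

Lemma tdim_le s : (tdim s <= size s * N)%N.
Proof.
have [x xE] := gdim_attained T (zip s (iota 0 (size s))); rewrite -[tdim s]xE.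
have {2}-> : size s = size (zip s (iota 0 (size s))) by rewrite size_zip size_iota minnn.
elim: (zip _ _) => [|p L IH]; first by rewrite /sumT big_nil dimv0.
rewrite sumT_cons mulSn (leq_trans (dimv_add_leqif _ _)) //.
exact: leq_add (T_dim _ _) IH.
Qed.

(** The number [c] bounds the increment of type [i]. If [s] is not stationary, adding some [j]
    lowers the increment by at least one; an increment of zero cannot drop further, so [s] is then
    stationary. *)
Lemma descent i s c : (tdim (i :: s) < tdim s + N)%N -> (tdim (i :: s) <= tdim s + c)%N ->
  exists s', (size s' <= size s + c)%N /\ tdim s' = \dim {:V}.
Proof.
elim: c s => [|c IH] s defect le_c.
  exists s; split; first by rewrite addn0.
  apply: (@stationary_full i) => // j.
  have := tdim_submodular i j s; have := tdim_mono i (j :: s); have := tdim_mono i s.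
  by move: le_c; lia.
have [stat|/existsNP[j /eqP nstat]] := pselect (forall j,
    tdim [:: i, j & s] + tdim s = tdim (i :: s) + tdim (j :: s))%N.
  by exists s; split; [apply: leq_addr|apply: stationary_full stat defect].
have sub := tdim_submodular i j s.
have [||s' [s's full]] := IH (j :: s).
- by move: defect nstat sub; lia.
- by move: le_c nstat sub; lia.
by exists s'; split=> //; rewrite addnS.
Qed.

Theorem tdim_max s : ((size s + N) * N <= \dim {:V})%N -> tdim s = (size s * N)%N.
Proof.
elim: s => [|i s IH] le.
  by apply/eqP; rewrite -leqn0; apply: tdim_le [::].
have {}IH : tdim s = (size s * N)%N.
  by apply/IH/leq_trans/le; rewrite leq_mul2r /= addSn leqnSn orbT.
apply/eqP; rewrite eqn_leq tdim_le /= leqNgt mulSn -IH; apply/negP => defect.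
have defect' : (tdim (i :: s) < tdim s + N)%N by rewrite addnC.
(* A dependent new summand has increment at most N - 1, so at most size s + N - 1 summands fill the
   space; their total dimension is below the assumed bound. *)
have [|s' [s's full]] := descent (c := N.-1) defect'.
  by move: defect'; case: (N) => [|N'] /=; lia.
have := tdim_le s'; rewrite full => le'.
have := leq_trans le le'; rewrite /= leq_mul2r.
by move: defect' (tdim_mono i s) s's; case: (N) => [|N'] /=; lia.
Qed.

Theorem sum_general_full_dim m (ty : 'I_m -> I) : ((m + N) * N <= \dim {:V})%N ->
  exists q : 'I_m -> S, \dim (\sum_i T (ty i) (q i)) = (m * N)%N.
Proof.
move=> le; pose L := [seq (ty j, val j) | j <- enum 'I_m].
have uL : uniq (unzip2 L) by rewrite /unzip2 -map_comp val_enum_ord iota_uniq.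
have szL : size (unzip1 L) = m by rewrite /unzip1 /L 2!size_map size_enum_ord.
have [x] := gdim_attained T L; rewrite gdimE // tdim_max szL // => xL.
exists (fun j => x j); rewrite -xL; congr (\dim _).
by rewrite /sumT big_map big_enum.
Qed.

End Descent.

(** * Quintic forms and tangent spaces *)

(* c = 15 for a Gaussian and c = 30 for a Laplace distribution. *)
Definition moment5 (R : comNzRingType) (c : nat) (l q : R) : R :=
  l ^+ 5 + (q * l ^+ 3) *+ 10 + (q ^+ 2 * l) *+ c.

(** The differential of [moment5 c] at (l, q) in the direction (dl, dq), that is A dl + B dq. *)
Definition dmoment5 (R : comNzRingType) (c : nat) (l q dl dq : R) : R :=
  ((l ^+ 4) *+ 5 + (q * l ^+ 2) *+ 30 + (q ^+ 2) *+ c) * dl +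
  (l ^+ 3 *+ 10 + (q * l) *+ (c * 2)) * dq.

Section MomentMorph.
Variables (R R' : comNzRingType) (f : {rmorphism R -> R'}) (c : nat).

Lemma rmorph_moment5 l q : f (moment5 c l q) = moment5 c (f l) (f q).
Proof. by rewrite /moment5 !(rmorphD, rmorphMn, rmorphM, rmorphXn). Qed.

Lemma rmorph_dmoment5 l q dl dq :
  f (dmoment5 c l q dl dq) = dmoment5 c (f l) (f q) (f dl) (f dq).
Proof. by rewrite /dmoment5 !(rmorphD, rmorphMn, rmorphM, rmorphXn). Qed.

End MomentMorph.

Lemma horner_dmoment5 (R : comNzRingType) c (l q dl dq : {poly R}) t :
  (dmoment5 c l q dl dq).[t] = dmoment5 c l.[t] q.[t] dl.[t] dq.[t].
Proof. exact: (rmorph_dmoment5 (horner_eval t)). Qed.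

Lemma meval_dmoment5 (R : comNzRingType) n c (l q dl dq : {mpoly R[n]}) v :
  (dmoment5 c l q dl dq).@[v] = dmoment5 c l.@[v] q.@[v] dl.@[v] dq.@[v].
Proof. exact: (rmorph_dmoment5 (meval v)). Qed.

Lemma meval_moment5 (R : comNzRingType) n c (l q : {mpoly R[n]}) v :
  (moment5 c l q).@[v] = moment5 c l.@[v] q.@[v].
Proof. exact: (rmorph_moment5 (meval v)). Qed.

Lemma dhomog_bigprod (R : comNzRingType) (n : nat) (I : Type) (r : seq I)
    (F : I -> {mpoly R[n]}) (d : I -> nat) :
  (forall i, F i \is (d i).-homog) -> \prod_(i <- r) F i \is (\sum_(i <- r) d i).-homog.
Proof.
move=> Fd; elim: r => [|i r IH]; first by rewrite !big_nil; apply: dhomog1.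
by rewrite !big_cons; apply: dhomogM.
Qed.

(** * Linear substitutions, homogeneous components and linear functionals *)

Section Substitution.
Variables (K : comNzRingType) (n : nat).
Implicit Types (g h : 'M[K]_n) (p : {mpoly K[n]}).

Definition lin_form (v : 'I_n -> K) : {mpoly K[n]} := \sum_j v j *: 'X_j.

Lemma lin_form_homog v : lin_form v \is 1.-homog.
Proof. by apply: rpred_sum => j _; apply: rpredZ; rewrite dhomogX; apply/eqP/mdeg1. Qed.

Definition msubst h p := p \mPo [tuple lin_form (h i) | i < n].

HB.instance Definition _ h := GRing.RMorphism.copy (msubst h)
  (comp_mpoly [tuple lin_form (h i) | i < n]).
HB.instance Definition _ h := GRing.Linear.copy (msubst h)
  (comp_mpoly [tuple lin_form (h i) | i < n]).

Lemma msubstX h i : msubst h 'X_i = lin_form (h i).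
Proof. by rewrite /msubst comp_mpolyXU -tnth_nth tnth_mktuple. Qed.

Lemma msubst_comp g h p : msubst h (msubst g p) = msubst (g *m h) p.
Proof.
elim/mpoly_ring_ind: p => [c|i|p q IHp IHq|p q IHp IHq].
- by rewrite /msubst !comp_mpolyC.
- rewrite !msubstX raddf_sum /lin_form /=.
  under eq_bigr => j _ do rewrite linearZ /= msubstX /lin_form scaler_sumr.
  rewrite exchange_big /=; apply: eq_bigr => k _; rewrite mxE scaler_suml.
  by apply: eq_bigr => j _; rewrite scalerA.
- by rewrite !raddfD /= IHp IHq.
- by rewrite !rmorphM /= IHp IHq.
Qed.

Lemma msubst1 p : msubst 1%:M p = p.
Proof.
rewrite -[RHS]comp_mpoly_id /msubst; congr (_ \mPo _); apply: eq_from_tnth => i.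
rewrite !tnth_mktuple /lin_form (bigD1 i) //= big1 ?addr0 => [|j ji].
  by rewrite mxE eqxx scale1r.
by rewrite mxE eq_sym (negbTE ji) scale0r.
Qed.

Lemma msubst_homog h d p : p \is d.-homog -> msubst h p \is d.-homog.
Proof.
move=> pd; rewrite /msubst comp_mpolyEX big_seq; apply: rpred_sum => m mp.
have -> : d = mdeg m := esym (dhomog_mf pd mp).
apply: rpredZ; rewrite comp_mpolyX mdegE.
apply: dhomog_bigprod => i; rewrite tnth_mktuple -[X in X.-homog]mul1n.
exact/dhomogMn/lin_form_homog.
Qed.

End Substitution.

Section HomogeneousProjection.
Variables (K : nzRingType) (n d : nat).

(** Taking the component of degree [d] gives a total linear map, which avoids carrying homogeneity
    proofs; on forms of degree [d] nothing is lost. *)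
Definition hproj (p : {mpoly K[n]}) : dhomog n K d := DHomog (pihomogP mdeg d p).

Lemma hproj_is_linear : linear hproj.
Proof. by move=> a p q; apply: val_inj; rewrite /= linearP. Qed.

HB.instance Definition _ :=
  GRing.isLinear.Build K {mpoly K[n]} (dhomog n K d) _ hproj hproj_is_linear.

Lemma hprojE p : p \is d.-homog -> val (hproj p) = p.
Proof. by move=> pd; apply: pihomog_dE. Qed.

Lemma hprojK (p : dhomog n K d) : hproj (val p) = p.
Proof. by apply/val_inj/hprojE/dhomog_is_dhomog. Qed.

End HomogeneousProjection.

Lemma dmoment5_homog (K : comNzRingType) (n c : nat) (l q dl dq : {mpoly K[n]}) :
  l \is 1.-homog -> q \is 2.-homog -> dl \is 1.-homog -> dq \is 2.-homog ->
  dmoment5 c l q dl dq \is 5.-homog.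
Proof.
move=> hl hq hdl hdq.
have hq2 : q ^+ 2 \is 4.-homog := dhomogMn 2 hq.
have hlk k : l ^+ k \is k.-homog by have := dhomogMn k hl; rewrite mul1n.
rewrite rpredD //.
  apply: (@dhomogM _ _ _ 4 _ 1) => //.
  by rewrite !rpredD ?rpredMn //; apply: (@dhomogM _ _ _ 2 _ 2).
apply: (@dhomogM _ _ _ 3 _ 2) => //.
by rewrite rpredD ?rpredMn //; apply: (@dhomogM _ _ _ 2 _ 1).
Qed.

Lemma scalar_hornerC (K : comNzRingType) (n : nat) (f : {mpoly K[n]} -> K)
    (p : {poly {mpoly K[n]}}) : scalar f ->
  exists q : {poly K}, forall t, f p.[t%:MP] = q.[t].
Proof.
move=> fl; pose fL : {linear {mpoly K[n]} -> K^o} := HB.pack f (GRing.isLinear.Build _ _ _ _ f fl).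
exists (\poly_(i < size p) f p`_i) => t.
rewrite horner_coef -[f]/(fL : _ -> _) linear_sum horner_poly; apply: eq_bigr => i _.
by rewrite -rmorphXn mulrC mul_mpolyC linearZ /= mulrC.
Qed.

(** The functional is a coordinate of u minus its projection to [U], chosen not to vanish at [v]. *)
Lemma separating_functional (K : fieldType) (V : vectType K) (U : {vspace V}) v :
  v \notin U -> exists f : V -> K,
    [/\ scalar f, forall u, u \in U -> f u = 0 & f v != 0].
Proof.
move=> vU; pose w u := u - projv U u.
have w0 : w v != 0.
  by apply: contra vU; rewrite subr_eq0 => /eqP ->; apply: memv_proj.
have [i wi] : exists i, coord (vbasis {:V}) i (w v) != 0.
  apply/existsP; apply: contra_neqT w0; rewrite negb_exists => /forallP w0.
  rewrite (coord_vbasis (memvf (w v))) big1 // => i _.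
  by move: (w0 i); rewrite negbK => /eqP ->; rewrite scale0r.
exists (fun u => coord (vbasis {:V}) i (w u)); split=> // [a x y|u uU].
  by rewrite /w -linearP; congr coord; rewrite linearP scalerBr opprD addrACA.
by rewrite /w projv_id // subrr linear0.
Qed.

Lemma poly_eq0_of_horner (K : numDomainType) (p : {poly K}) : (forall t, p.[t] = 0) -> p = 0.
Proof. by move=> p0; apply: contraTeq isT => /poly_nonroot[t]; rewrite p0 eqxx. Qed.

Lemma mpoly_rmorph_ext (R : comNzRingType) (n : nat) (R' : pzSemiRingType)
    (f g : {rmorphism {mpoly R[n]} -> R'}) :
  (forall c, f c%:MP = g c%:MP) -> (forall i, f 'X_i = g 'X_i) -> f =1 g.
Proof.
move=> fgC fgX p; elim/mpoly_ring_ind: p => [//|//|p q IHp IHq|p q IHp IHq].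
  by rewrite !rmorphD IHp IHq.
by rewrite !rmorphM IHp IHq.
Qed.

Lemma mnm_peel n d (m : 'X_{1..n}) : mdeg m = d.+1 ->
  exists i m', m = (U_(i) + m')%MM /\ mdeg m' = d.
Proof.
move=> md; have [i mi] : exists i, m i != 0%N.
  apply/existsP; apply: contra_eqT md; rewrite negb_exists => /forallP m0.
  by rewrite mdegE big1 // => i _; apply/eqP; move: (m0 i); rewrite negbK.
exists i, (m - U_(i))%MM.
have mE : m = (U_(i) + (m - U_(i)))%MM.
  rewrite addmC submK //; apply/mnm_lepP => j.
  by rewrite mnm1E; case: eqP => // <-; rewrite lt0n.
by split=> //; move: md; rewrite {1}mE mdegD mdeg1 add1n => -[].
Qed.

(** * Quintic forms as an irreducible representation of GL_n *)

Section Orbit.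
Variables (K : numFieldType) (n' d : nat).
Local Notation n := n'.+1.
Local Notation V d := (dhomog n K d).
Implicit Types (h : 'M[K]_n).

Definition dsubst h (p : V d) : V d := hproj d (msubst h (val p)).

Lemma dsubst_is_linear h : linear (dsubst h).
Proof. by move=> a p q; rewrite /dsubst !linearP. Qed.

HB.instance Definition _ h := GRing.isLinear.Build K (V d) (V d) _ (dsubst h) (dsubst_is_linear h).

Lemma val_dsubst h p : val (dsubst h p) = msubst h (val p).
Proof. by apply/hprojE/msubst_homog/dhomog_is_dhomog. Qed.

Lemma dsubst_comp g h p : dsubst h (dsubst g p) = dsubst (g *m h) p.
Proof. by apply: val_inj; rewrite !val_dsubst msubst_comp. Qed.

Lemma dsubst1 p : dsubst 1%:M p = p.
Proof. by apply: val_inj; rewrite val_dsubst msubst1. Qed.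

(* h + t is invertible for all but finitely many t. *)
Lemma dsubst_closure (U : {vspace V d}) e :
  (forall h, h \in unitmx -> dsubst h e \in U) -> forall h, dsubst h e \in U.
Proof.
move=> eU h; apply: contraT => /separating_functional[f [fl fU fe]].
(* The form [e] under the substitution h + t, with t as a polynomial variable. *)
pose G : {poly {mpoly K[n]}} := mmap (polyC \o @mpolyC n K)
  (fun i => (lin_form (h i))%:P + ('X_i)%:P * 'X) (val e).
have GE t : G.[t%:MP] = msubst (h + t%:M) (val e).
  pose phi : {rmorphism {mpoly K[n]} -> {mpoly K[n]}} :=
    horner_eval t%:MP \o
    mmap (polyC \o @mpolyC n K) (fun i => (lin_form (h i))%:P + ('X_i)%:P * 'X).
  rewrite -[LHS]/(phi (val e)); apply: mpoly_rmorph_ext => [c|i].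
    by rewrite /= mmapC /msubst comp_mpolyC /horner_eval /= hornerC.
  rewrite /= mmapX mmap1U msubstX /horner_eval !hornerE /lin_form.
  rewrite [RHS](eq_bigr (fun j => h i j *: 'X_j + (t%:M : 'M_n) i j *: 'X_j)); last first.
    by move=> j _; rewrite mxE scalerDl.
  rewrite big_split /=; congr (_ + _); rewrite (bigD1 i) //= big1 ?addr0.
    by rewrite mxE eqxx mulrC mul_mpolyC.
  by move=> j ji; rewrite mxE eq_sym (negbTE ji) scale0r.
have [|p pE] := @scalar_hornerC _ _ (fun q => f (hproj d q)) G.
  by move=> a p q; rewrite linearP fl.
(* The first factor vanishes when h + t is invertible, the second, which is \det (h + t), when it is
   not. As the characteristic polynomial is monic, p = 0, in contradiction to its value at t = 0. *)
have p0 : p * char_poly (- h) = 0.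
  apply: poly_eq0_of_horner => t; rewrite hornerM.
  have [|dt] := boolP (h + t%:M \in unitmx).
    by move/eU/fU; rewrite -pE GE => ->; rewrite mul0r.
  apply/eqP; rewrite mulf_eq0; apply/orP; right.
  have -> : (char_poly (- h)).[t] = \det (h + t%:M).
    rewrite -[_.[t]]/(horner_eval t (char_poly (- h))) -det_map_mx; congr (\det _).
    apply/matrixP => i j; rewrite !mxE -[LHS]/(_.[t]).
    by rewrite hornerD hornerN hornerC hornerMn hornerX opprK addrC.
  by move: dt; rewrite unitmxE unitfE negbK.
move/eqP: p0; rewrite mulf_eq0 (negbTE (monic_neq0 (char_poly_monic _))) orbF => /eqP p0.
by move: fe; rewrite /dsubst -[h]addr0 -[0](raddf0 (@scalar_mx K n)) -GE pE p0 horner0 eqxx.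
Qed.

End Orbit.

Section Irreducible.
Variables (K : numFieldType) (n' : nat).
Local Notation n := n'.+1.
Local Notation V d := (dhomog n K d).

(** Each variable X_i becomes a_i times the same linear form, so homogeneity pulls out the value at
    [a]. *)
Lemma msubst_rank1 d (p : {mpoly K[n]}) (a b : 'I_n -> K) : p \is d.-homog ->
  msubst (\matrix_(i, j) (a i * b j)) p = p.@[a] *: lin_form b ^+ d.
Proof.
move=> pd; rewrite /msubst comp_mpolyEX mevalE scaler_suml.
apply: eq_big_seq => m mp; have -> : d = mdeg m := esym (dhomog_mf pd mp).
rewrite -scalerA; congr (_ *: _); rewrite comp_mpolyX.
rewrite mdegE (big_morph _ (exprD (lin_form b)) (expr0 _)) -scaler_prod.
apply: eq_bigr => i _; rewrite tnth_mktuple -exprZn; congr (_ ^+ _).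
rewrite /lin_form scaler_sumr; apply: eq_bigr => j _.
by rewrite mxE scalerA.
Qed.

Lemma lin_form_coeff (l : {mpoly K[n]}) : l \is 1.-homog -> l = lin_form (fun i => l@_(U_(i))).
Proof.
move=> l1; apply/mpolyP => m; rewrite /lin_form raddf_sum /=.
have [/eqP/mdeg1P[i /eqP ->]|m1] := eqVneq (mdeg m) 1%N.
  rewrite (bigD1 i) //= mcoeffZ mcoeffX eqxx mulr1 big1 ?addr0 // => j ji.
  rewrite mcoeffZ mcoeffX; case: eqP => [/mnmP/(_ i)|]; last by rewrite mulr0.
  by rewrite !mnm1E eqxx (negbTE ji).
rewrite (dhomog_nemf_coeff l1 m1) big1 // => j _; rewrite mcoeffZ mcoeffX.
by case: (U_(j)%MM =P m) m1 => [<-|]; rewrite ?mulr0 // mdeg1.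
Qed.

(** Inclusion-exclusion over the nonempty subsets of the five factors; 120 = 5! is the coefficient
    of abcde in (a + b + c + d + e)^5. *)
Lemma polarization5 (R : comNzRingType) (linear_form Q : R -> Prop) (a b c d e : R) :
  (forall x y, linear_form x -> linear_form y -> linear_form (x + y)) ->
  (forall x y, Q x -> Q y -> Q (x + y)) -> (forall x y, Q x -> Q y -> Q (x - y)) ->
  (forall x, linear_form x -> Q (x ^+ 5)) ->
  linear_form a -> linear_form b -> linear_form c -> linear_form d -> linear_form e ->
  Q ((a * b * c * d * e) *+ 120).
Proof.
move=> lD QD QB Q5 la lb lc ld le.
have -> : (a * b * c * d * e) *+ 120 = (a + b + c + d + e) ^+ 5
  - ((b + c + d + e) ^+ 5 + (a + c + d + e) ^+ 5 + (a + b + d + e) ^+ 5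
     + (a + b + c + e) ^+ 5 + (a + b + c + d) ^+ 5)
  + ((a + b + c) ^+ 5 + (a + b + d) ^+ 5 + (a + b + e) ^+ 5 + (a + c + d) ^+ 5
     + (a + c + e) ^+ 5 + (a + d + e) ^+ 5 + (b + c + d) ^+ 5 + (b + c + e) ^+ 5
     + (b + d + e) ^+ 5 + (c + d + e) ^+ 5)
  - ((a + b) ^+ 5 + (a + c) ^+ 5 + (a + d) ^+ 5 + (a + e) ^+ 5 + (b + c) ^+ 5
     + (b + d) ^+ 5 + (b + e) ^+ 5 + (c + d) ^+ 5 + (c + e) ^+ 5 + (d + e) ^+ 5)
  + (a ^+ 5 + b ^+ 5 + c ^+ 5 + d ^+ 5 + e ^+ 5) by ring.
by repeat first [apply: (QB)|apply: (QD)]; apply: (Q5) => //; repeat apply: (lD).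
Qed.

(** By closure [U] also contains the rank one substitutions of [e], hence all fifth powers of linear
    forms; polarization then gives all monomials. *)
Lemma quintic_irreducible (e : V 5) (U : {vspace V 5}) : e != 0 ->
  (forall h, h \in unitmx -> dsubst h e \in U) -> U = fullv.
Proof.
move=> e0 /dsubst_closure eU.
have [a ea] : exists a, (val e).@[a] != 0 by apply: mpoly_nonroot.
have pow5 b : hproj 5 (lin_form b ^+ 5) \in U.
  have := eU (\matrix_(i, j) (a i * b j)).
  rewrite /dsubst (msubst_rank1 _ _ (dhomog_is_dhomog e)) linearZ /=.
  by rewrite rpredZeq => /orP[ea0|//]; case/negP: ea.
have lin1 (l : {mpoly K[n]}) : l \is 1.-homog -> hproj 5 (l ^+ 5) \in U.
  by move=> /lin_form_coeff ->; apply: pow5.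
have prod5 (i1 i2 i3 i4 i5 : 'I_n) :
    hproj 5 ('X_i1 * 'X_i2 * 'X_i3 * 'X_i4 * 'X_i5) \in U.
  have X1 (i : 'I_n) : 'X_i \is [in K[n], 1.-homog].
    by rewrite dhomogX; apply/eqP/mdeg1.
  have n120 : (120%:R : K) != 0 by rewrite pnatr_eq0.
  have -> : 'X_i1 * 'X_i2 * 'X_i3 * 'X_i4 * 'X_i5 =
    120%:R^-1 *: (('X_i1 * 'X_i2 * 'X_i3 * 'X_i4 * 'X_i5) *+ 120) :> {mpoly K[n]}.
    by rewrite -scaler_nat scalerA mulVf // scale1r.
  rewrite linearZ; apply: memvZ.
  apply: (@polarization5 _ (fun l => l \is 1.-homog) (fun x => hproj 5 x \in U)) => // x y.
  - exact: rpredD.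
  - by move=> xU yU; rewrite linearD memvD.
  - by move=> xU yU; rewrite linearB memvB.
apply/eqP; rewrite eqEsubv subvf /=; apply/subvP => v _.
rewrite -[v]hprojK (mpolyE (val v)) linear_sum big_seq /=.
apply: memv_suml => m mv; rewrite linearZ; apply: memvZ.
have m5 : mdeg m = 5 := dhomog_mf (dhomog_is_dhomog v) mv.
have [i1 [m4 [-> /mnm_peel[i2 [m3 [-> /mnm_peel[i3 [m2 [->]]]]]]]]] := mnm_peel m5.
move=> /mnm_peel[i4 [m1 [-> /mnm_peel[i5 [m0 [->]]]]]].
move=> /eqP; rewrite mdeg_eq0 => /eqP ->.
rewrite addm0 !mpolyXD !mulrA; exact: prod5.
Qed.

End Irreducible.

(** * Tangent spaces of the single components *)

Definition lead (gaussian : bool) : nat := if gaussian then 15 else 30.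

Section Tangent.
Variables (K : numFieldType) (n' : nat).
Local Notation n := n'.+1.
Local Notation V d := (dhomog n K d).
Local Notation S := (V 1 * V 2)%type.
Implicit Types (b : bool) (s u : S) (h : 'M[K]_n).

Definition tangent b s u : V 5 :=
  hproj 5 (dmoment5 (lead b) (val s.1) (val s.2) (val u.1) (val u.2)).

Lemma tangent_is_linear b s : linear (tangent b s).
Proof.
move=> a u v; rewrite /tangent -linearP; congr (hproj 5 _).
have lin (A B x x' y y' : {mpoly K[n]}) :
  A * (a *: x + x') + B * (a *: y + y') = a *: (A * x + B * y) + (A * x' + B * y').
  by rewrite !mulrDr -!scalerAr scalerDr addrACA.
exact: lin.
Qed.

HB.instance Definition _ b s :=
  GRing.isLinear.Build K S (V 5) _ (tangent b s) (tangent_is_linear b s).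

Lemma val_tangent b s u :
  val (tangent b s u) = dmoment5 (lead b) (val s.1) (val s.2) (val u.1) (val u.2).
Proof. by apply/hprojE/dmoment5_homog; apply: dhomog_is_dhomog. Qed.

Definition tangent_space b s : {vspace V 5} := limg (linfun (tangent b s)).

Lemma tangent_spaceP b s v :
  reflect (exists u, v = tangent b s u) (v \in tangent_space b s).
Proof.
apply: (iffP memv_imgP) => [[u _ ->]|[u ->]]; exists u; rewrite ?lfunE ?memvf //.
Qed.

Lemma dim_parameters : \dim {: S} = ('C(n + 1, 2) + n)%N.
Proof.
rewrite dimvf /dim /= -[X in (X + _)%N]/('C(1 + n', 1)) -[X in (_ + X)%N]/('C(2 + n', 2)).
by rewrite bin1 addn1 add1n add2n addnC.
Qed.

Lemma dim_quintics : \dim {: V 5} = 'C(n + 4, 5).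
Proof. by rewrite dimvf /dim /= addSnnS addnC. Qed.

Lemma dim_tangent_space b s : (\dim (tangent_space b s) <= 'C(n + 1, 2) + n)%N.
Proof. by rewrite -dim_parameters -(limg_ker_dim (linfun (tangent b s)) fullv) leq_addl. Qed.

(** The direction [u] stays fixed while the base point moves along the line; the tangent vector is
    then polynomial in t. *)
Lemma tangent_space_lift b s0 s1 v : v \in tangent_space b s0 ->
  exists c, [/\ poly_curve c, c 0 = v & forall t, c t \in tangent_space b (s0 + t *: (s1 - s0))].
Proof.
move=> /tangent_spaceP[u ->].
exists (fun t => tangent b (s0 + t *: (s1 - s0)) u); split=> [f fl||t]; last 2 first.
- by rewrite scale0r addr0.
- by apply/tangent_spaceP; exists u.
have [P PE] : exists P : {mpoly K[n]} -> {mpoly K[n]} -> {poly {mpoly K[n]}},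
    forall p0 p1 t, (P p0 p1).[t%:MP] = p0 + t *: (p1 - p0).
  exists (fun p0 p1 => p0%:P + 'X * (p1 - p0)%:P) => p0 p1 t.
  by rewrite hornerD hornerM !hornerC hornerX mul_mpolyC.
have [|q qE] := @scalar_hornerC _ _ (fun p => f (hproj 5 p))
    (dmoment5 (lead b) (P (val s0.1) (val s1.1)) (P (val s0.2) (val s1.2))
       (val u.1)%:P (val u.2)%:P).
  by move=> a p q; rewrite linearP fl.
exists q => t; rewrite -qE horner_dmoment5 [X in f X = _]/tangent.
by do 2 congr (_ _); rewrite !PE !hornerC.
Qed.

Definition psubst h s : S := (dsubst h s.1, dsubst h s.2).

Lemma psubst_comp g h s : psubst h (psubst g s) = psubst (g *m h) s.
Proof. by rewrite /psubst !dsubst_comp. Qed.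

Lemma psubst1 s : psubst 1%:M s = s.
Proof. by case: s => l q; rewrite /psubst !dsubst1. Qed.

Lemma dsubst_tangent h b s u : dsubst h (tangent b s u) = tangent b (psubst h s) (psubst h u).
Proof. by apply: val_inj; rewrite val_dsubst !val_tangent rmorph_dmoment5 !val_dsubst. Qed.

Definition GLn := {h : 'M[K]_n | h \in unitmx}.

Definition GLact (g : GLn) : 'End(V 5) := linfun (dsubst (val g)).

Lemma GLact_inj g : lker (GLact g) = 0%VS.
Proof.
apply/eqP/lker0P => p q; rewrite !lfunE /= => /(congr1 (dsubst (invmx (val g)))).
by rewrite !dsubst_comp mulmxV ?(valP g) // !dsubst1.
Qed.

Lemma tangent_space_equivariant g b s :
  tangent_space b (psubst (val g) s) = (GLact g @: tangent_space b s)%VS.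
Proof.
apply/vspaceP => v; apply/tangent_spaceP/memv_imgP => [[u ->]|[w /tangent_spaceP[u ->] ->]].
  pose u' := psubst (invmx (val g)) u.
  exists (tangent b s u'); first by apply/tangent_spaceP; exists u'.
  by rewrite lfunE /= dsubst_tangent psubst_comp mulVmx ?(valP g) // psubst1.
by exists (psubst (val g) u); rewrite lfunE /= dsubst_tangent.
Qed.

Lemma GLact_irreducible (e : V 5) (U : {vspace V 5}) : e != 0 ->
  (forall g, GLact g e \in U) -> U = fullv.
Proof.
move=> e0 eU; apply: (quintic_irreducible e0) => h hu.
by have := eU (exist _ h hu); rewrite lfunE.
Qed.

End Tangent.

Section GeneralTangent.
Variables (K : numClosedFieldType) (n' : nat).
Local Notation n := n'.+1.
Local Notation V d := (dhomog n K d).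

Lemma dim_tangent_space_general b : (0 < n')%N ->
  exists s : V 1 * V 2, \dim (tangent_space b s) = ('C(n + 1, 2) + n)%N.
Proof.
move=> n0; pose i0 : 'I_n := ord0; pose i1 : 'I_n := ord_max.
have i10 : i1 != i0 by rewrite -val_eqE /= -lt0n.
have X1 (i : 'I_n) : 'X_i \is [in K[n], 1.-homog] by rewrite dhomogX; apply/eqP/mdeg1.
have X2 (i : 'I_n) : 'X_i ^+ 2 \is [in K[n], 2.-homog] by apply: dhomogMn (X1 i).
(* At l = X_0, q = X_{n'}^2 the linear part dl is a multiple of X_0, because A = c X_{n'}^4
   on X_0 = 0; it vanishes, because B has a zero at which neither A nor X_0 vanishes. *)
pose s : V 1 * V 2 := (DHomog (X1 i0), DHomog (X2 i1)).
exists s; rewrite -(dim_parameters K) limg_dim_eq // capfv; apply/eqP; rewrite -subv0.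
apply/subvP => -[dl dq]; rewrite memv_ker lfunE /= => /eqP/(congr1 val).
rewrite val_tangent /=; set c := lead b => E.
have c0 : c%:R != 0 :> K by rewrite /c; case: (b); rewrite pnatr_eq0.
have Ev (v : 'I_n -> K) :
    (v i0 ^+ 4 *+ 5 + (v i1 ^+ 2 * v i0 ^+ 2) *+ 30 + (v i1 ^+ 2) ^+ 2 *+ c) * (val dl).@[v]
    + (v i0 ^+ 3 *+ 10 + (v i1 ^+ 2 * v i0) *+ (c * 2)) * (val dq).@[v] = 0.
  by have := congr1 (meval v) E; rewrite meval0 rmorph_dmoment5 rmorphXn /= !mevalXU.
pose a (i : 'I_n) : K := (val dl)@_(U_(i)).
have dlE : val dl = lin_form a by apply/lin_form_coeff/dhomog_is_dhomog.
have dlv v : (val dl).@[v] = \sum_i a i * v i.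
  rewrite dlE /lin_form raddf_sum; apply: eq_bigr => i _.
  by rewrite /= mevalZ mevalXU.
have a_eq0 i : i != i0 -> a i = 0.
  have at1 v : v i0 = 0 -> v i1 = 1 -> \sum_i a i * v i = 0.
    move=> v0 v1; have := Ev v; rewrite v0 v1 !expr0n /= !mulr0 !mul0rn !add0r.
    rewrite mul0r addr0 !expr1n dlv => /eqP.
    by rewrite mulf_eq0 (negbTE c0) => /eqP.
  have delta (j : 'I_n) : \sum_i a i * (i == j)%:R = a j.
    by rewrite (bigD1 j) //= eqxx mulr1 big1 ?addr0 // => k /negbTE ->; rewrite mulr0.
  have a1 : a i1 = 0.
    by rewrite -delta; apply: at1; rewrite ?eqxx // eq_sym (negbTE i10).
  have [-> //|ii1 ii0] := eqVneq i i1.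
  have := at1 (fun j => (j == i1)%:R + (j == i)%:R); rewrite eqxx.
  rewrite [i0 == i1]eq_sym (negbTE i10) [i0 == i]eq_sym (negbTE ii0).
  rewrite [i1 == i]eq_sym (negbTE ii1) !addr0 => /(_ erefl erefl).
  under eq_bigr => j _ do rewrite mulrDr.
  by rewrite big_split /= !delta a1 add0r.
have dl0v v : (val dl).@[v] = a i0 * v i0.
  rewrite dlv (bigD1 i0) //= big1 ?addr0 // => i /a_eq0 ->.
  by rewrite mul0r.
have a0 : a i0 = 0.
  (* At X_0 = z and all other variables 1, B = 2 z (5 z^2 + c) vanishes, while A = 5 z^4 + 30 z^2 +
     c = (c / 5) (c - 25) is nonzero for c = 15 and c = 30. *)
  pose z : K := sqrtC (- c%:R / 5%:R).
  have z2 : z ^+ 2 = - c%:R / 5%:R by rewrite sqrtCK.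
  have n5 : (5%:R : K) != 0 by rewrite pnatr_eq0.
  have z0 : z != 0.
    by rewrite -sqrf_eq0 z2 mulf_neq0 ?oppr_eq0 ?invr_eq0.
  have := Ev (fun j => if j == i0 then z else 1); rewrite dl0v eqxx (negbTE i10).
  have z4 : z ^+ 4 = (z ^+ 2) ^+ 2 by rewrite -exprM.
  have z3 : z ^+ 3 = z ^+ 2 * z by rewrite -exprSr.
  rewrite !expr1n !mul1r z4 z3 z2 => E0.
  have : (c%:R / 5%:R * (c%:R - 25%:R)) * (a i0 * z) = 0 :> K.
    by rewrite -[RHS]E0; field.
  move/eqP; rewrite !mulf_eq0 (negbTE c0) invr_eq0 (negbTE n5) (negbTE z0) orbF /=.
  case/orP => [|/orP[/eqP //|//]]; by rewrite subr_eq0 eqr_nat /c; case: (b).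
have dl0 : val dl = 0.
  rewrite dlE /lin_form big1 // => i _; have [->|/a_eq0 ->] := eqVneq i i0.
    by rewrite a0 scale0r.
  by rewrite scale0r.
have dq0 : val dq = 0.
  move: E; rewrite /dmoment5 dl0 mulr0 add0r => /eqP; rewrite mulf_eq0 => /orP[/eqP B0|/eqP //].
  (* This is B, whose value 10 + 2 c at the all-ones point is nonzero. *)
  have : dmoment5 c 'X_i0 ('X_i1 ^+ 2) 0 1 = 0 :> {mpoly K[n]}.
    by rewrite /dmoment5 mulr0 add0r mulr1.
  move/(congr1 (meval (fun=> 1))); rewrite meval_dmoment5 rmorphXn /= !mevalXU meval0 meval1.
  rewrite /dmoment5 mulr0 add0r !expr1n !mul1r mulr1 => /eqP.
  by rewrite -natrD pnatr_eq0 addn_eq0.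
by rewrite memv0; apply/eqP; congr pair; apply: val_inj.
Qed.

End GeneralTangent.

Lemma mderiv_moment5 (R : comNzRingType) n c (l q : {mpoly R[n]}) j :
  (moment5 c l q)^`M(j) = dmoment5 c l q l^`M(j) q^`M(j).
Proof.
rewrite /moment5 /dmoment5 !(mderivD, mderivMn) !exprS !expr0 !mulr1.
rewrite !mderivM; ring.
Qed.

Section Coefficientwise.
Variables (K : comNzRingType) (n M : nat) (f : {mpoly K[n]} -> K).
Hypothesis f_lin : scalar f.

(** Applying [f] to every coefficient commutes with evaluation at scalars and with derivatives. This
    turns a functional of the mixture into an ordinary polynomial in the parameters. *)
Lemma coefficientwise (G : {mpoly {mpoly K[n]}[M]}) : exists F : {mpoly K[M]},
  (forall y, F.@[y] = f G.@[fun k => (y k)%:MP]) /\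
  (forall y j, F^`M(j).@[y] = f G^`M(j).@[fun k => (y k)%:MP]).
Proof.
pose fL : {linear {mpoly K[n]} -> K^o} :=
  HB.pack f (GRing.isLinear.Build _ _ _ _ f f_lin).
have evalE (H : {mpoly {mpoly K[n]}[M]}) y :
    (map_mpoly fL H).@[y] = f H.@[fun k => (y k)%:MP].
  rewrite (map_mpolyE fL (leqnn _)) [in RHS](mpolywE (leqnn (msize H))).
  rewrite -[f]/(fL : _ -> _) (raddf_sum (meval y)) (raddf_sum (meval _)) (raddf_sum fL).
  apply: eq_bigr => m _; rewrite /=.
  rewrite !mevalZ !mevalX; set c := \prod_i _ ^+ _.
  have -> : \prod_i (y i)%:MP ^+ m i = c%:MP :> {mpoly K[n]}.
    by rewrite /c rmorph_prod; apply: eq_bigr => i _; rewrite rmorphXn.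
  by rewrite [in RHS]mulrC mul_mpolyC -[f]/(fL : _ -> _) linearZ mulrC.
exists (map_mpoly fL G); split=> // y j; rewrite -evalE; congr (_.@[_]).
apply/mpolyP => m; rewrite mcoeff_mderiv !mcoeff_map_mpoly mcoeff_mderiv.
by rewrite raddfMn.
Qed.

End Coefficientwise.

(** * The mixture map *)

Section Mixture.
Variables (K : numClosedFieldType) (n' m : nat) (ty : 'I_m -> bool).
Local Notation n := n'.+1.
Local Notation V d := (dhomog n K d).
Local Notation S := (V 1 * V 2)%type.
Local Notation X := {ffun 'I_m -> S}.
Implicit Types (x u : X).

Definition mixture x : {mpoly K[n]} :=
  \sum_i moment5 (lead (ty i)) (val (x i).1) (val (x i).2).

(** The differential of [mixture] at [x] in the direction [u]. *)
Definition dmixture x u : V 5 := \sum_i tangent (ty i) (x i) (u i).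

Lemma dmixture_is_linear x : linear (dmixture x).
Proof.
move=> a u v; rewrite /dmixture scaler_sumr -big_split /=; apply: eq_bigr => i _.
by rewrite !ffunE linearP.
Qed.

HB.instance Definition _ x :=
  GRing.isLinear.Build K X (V 5) _ (dmixture x) (dmixture_is_linear x).

(** The image contains every tangent space, so its dimension is at least that of the source;
    rank-nullity leaves no kernel. *)
Lemma dmixture_inj x :
  \dim (\sum_i tangent_space (ty i) (x i))%VS = (m * ('C(n + 1, 2) + n))%N ->
  lker (linfun (dmixture x)) = 0%VS.
Proof.
move=> dimT; apply/eqP; rewrite -dimv_eq0 -leqn0.
have dimX : \dim {: X} = (m * ('C(n + 1, 2) + n))%N.
  by rewrite -(dim_parameters K n') !dimvf {1}/dim /= card_ord.
have := limg_ker_dim (linfun (dmixture x)) fullv; rewrite capfv dimX -dimT.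
have : (\sum_i tangent_space (ty i) (x i) <= limg (linfun (dmixture x)))%VS.
  apply/subv_sumP => i _; apply/subvP => v /tangent_spaceP[u ->].
  apply/memv_imgP; exists [ffun j => if j == i then u else 0]; rewrite ?memvf // lfunE /=.
  rewrite /dmixture (bigD1 i) //= ffunE eqxx big1 ?addr0 // => j ji.
  by rewrite ffunE (negbTE ji) linear0.
by move=> /dimvS le E; rewrite -(leq_add2r (\dim (limg (linfun (dmixture x))))) E add0n.
Qed.

Local Notation M := (\dim {: X}).
Local Notation b := (vbasis {: X}).
Definition vec (y : 'I_M -> K) : X := \sum_k y k *: b`_k.

Lemma vec_coord x : vec (fun k => coord b k x) = x.
Proof. exact/esym/coord_vbasis/memvf. Qed.

(* The mixture with indeterminate coordinates; its coefficients are polynomials in t. *)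
Definition universal_mixture : {mpoly {mpoly K[n]}[M]} :=
  \sum_i moment5 (lead (ty i)) (\sum_(k < M) val ((b`_k : X) i).1 *: 'X_k)
    (\sum_(k < M) val ((b`_k : X) i).2 *: 'X_k).

Lemma meval_linear (p : 'I_M -> {mpoly K[n]}) (y : 'I_M -> K) :
  (\sum_k p k *: 'X_k).@[fun k => (y k)%:MP] = \sum_k y k *: p k.
Proof.
rewrite raddf_sum /=; apply: eq_bigr => k _.
by rewrite mevalZ mevalXU mulrC mul_mpolyC.
Qed.

Lemma mderiv_linear (p : 'I_M -> {mpoly K[n]}) j :
  (\sum_k p k *: 'X_k)^`M(j) = (p j)%:MP.
Proof.
rewrite raddf_sum /= (bigD1 j) //= big1 => [|k kj]; rewrite mderivZ mderivX mnm1E.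
  by rewrite eqxx scale1r addr0 -{1}[U_(j)%MM]add0m addmK mpolyX0 alg_mpolyC.
by rewrite (negbTE kj) scale0r scaler0.
Qed.

Lemma val_vec1 y i : val (vec y i).1 = \sum_k y k *: val ((b`_k : X) i).1.
Proof.
rewrite /vec sum_ffunE (raddf_sum fst) (raddf_sum (@mpoly_of_dhomog _ _ _)) /=.
by apply: eq_bigr => k _; rewrite !ffunE.
Qed.

Lemma val_vec2 y i : val (vec y i).2 = \sum_k y k *: val ((b`_k : X) i).2.
Proof.
rewrite /vec sum_ffunE (raddf_sum snd) (raddf_sum (@mpoly_of_dhomog _ _ _)) /=.
by apply: eq_bigr => k _; rewrite !ffunE.
Qed.

Lemma meval_universal y : universal_mixture.@[fun k => (y k)%:MP] = mixture (vec y).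
Proof.
rewrite /universal_mixture raddf_sum; apply: eq_bigr => i _ /=.
by rewrite meval_moment5 !meval_linear -val_vec1 -val_vec2.
Qed.

Lemma meval_mderiv_universal y j :
  universal_mixture^`M(j).@[fun k => (y k)%:MP] = val (dmixture (vec y) b`_j).
Proof.
rewrite /universal_mixture (raddf_sum (mderiv j)) (raddf_sum (meval _)) /dmixture.
rewrite [RHS](raddf_sum (@mpoly_of_dhomog _ _ _)); apply: eq_bigr => i _ /=.
rewrite mderiv_moment5 meval_dmoment5 !mderiv_linear !mevalC !meval_linear.
by rewrite -val_vec1 -val_vec2; apply: esym; apply: val_tangent.
Qed.

Lemma mixture_generic_fiber x0 : lker (linfun (dmixture x0)) = 0%VS ->
  exists2 P : {mpoly K[M]}, P != 0 & forall y, P.@[y] != 0 ->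
    exists r : 'I_M -> {poly K}, (forall j, r j != 0) /\
      forall x, mixture x = mixture (vec y) -> forall j, root (r j) (coord b j x).
Proof.
move=> inj0; pose y0 k := coord b k x0.
pose L := linfun (dmixture x0).
(* Composing with a left inverse of the differential at [x0] gives a square system whose Jacobian
   there is the identity. *)
pose f i p : K := coord b i ((L^-1)%VF (hproj 5 p)).
have f_lin i : scalar (f i) by move=> a p q; rewrite /f !linearP.
have /fin_all_exists[F FP] i := coefficientwise (f_lin i) universal_mixture.
have [i j|P P0 PF] := @generic_fiber_roots _ _ F y0.
  have [_ ->] := FP i; rewrite meval_mderiv_universal vec_coord /f hprojK.
  rewrite -[dmixture x0 _](lfunE (dmixture x0)) lker0_lfunK ?inj0 //.
  by rewrite coord_free ?(basis_free (vbasisP _)) // eq_sym.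
exists P => // y /PF[r [r0 rF]]; exists r; split=> // x mx j.
apply: (rF (fun k => coord b k x)) => i.
by have [FE _] := FP i; rewrite !FE !meval_universal vec_coord mx.
Qed.

End Mixture.

(** * Passage between parameters and pairs of forms *)

Lemma mnm1D_eq n (i j a b : 'I_n) :
  ((U_(i) + U_(j))%MM == (U_(a) + U_(b))%MM) =
  ((i, j) == (a, b)) || ((i, j) == (b, a)).
Proof.
apply/eqP/orP => [E|[/eqP[-> ->]|/eqP[-> ->]] //]; last exact: addmC.
have inj (k l : 'I_n) : U_(k)%MM = U_(l)%MM -> k = l.
  by move/mnmP/(_ k); rewrite !mnm1E eqxx; case: eqP.
have /mnmP/(_ a) := E; rewrite !mnmDE !mnm1E eqxx.
have [ia|_] := eqVneq i a.
  by move: E; rewrite ia => /addmI/inj ->; left.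
have [ja|_ //] := eqVneq j a.
by move: E; rewrite ja addmC => /addmI/inj ->; right.
Qed.

Section Coordinates.
Variables (K : numClosedFieldType) (n' m : nat).
Local Notation n := n'.+1.
Local Notation V d := (dhomog n K d).
Local Notation X := {ffun 'I_m -> V 1 * V 2}.
Implicit Types (theta : params K n m) (x : X).

Lemma mean_form_homog (mu : 'cV[K]_n) : mean_form mu \is 1.-homog.
Proof. exact: lin_form_homog. Qed.

Lemma cov_form_homog (Sigma : 'M[K]_n) : cov_form Sigma \is 2.-homog.
Proof.
apply: rpred_sum => i _; apply: rpred_sum => j _; apply: rpredZ.
by rewrite -mpolyXD dhomogX; apply/eqP; rewrite /= mdegD !mdeg1.
Qed.

Lemma mcoeff_mean_form (mu : 'cV[K]_n) a : (mean_form mu)@_(U_(a)) = mu a 0.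
Proof.
rewrite /mean_form raddf_sum (bigD1 a) //= mcoeffZ mcoeffX eqxx mulr1.
rewrite big1 ?addr0 // => i ia; rewrite mcoeffZ mcoeffX.
case: eqP => [/mnmP/(_ a)|]; last by rewrite mulr0.
by rewrite !mnm1E eqxx (negbTE ia).
Qed.

Lemma mcoeff_cov_form (Sigma : 'M[K]_n) a b :
  (cov_form Sigma)@_(U_(a) + U_(b)) =
  if a == b then Sigma a b else Sigma a b + Sigma b a.
Proof.
rewrite /cov_form pair_bigA raddf_sum /=.
under eq_bigr => p _ do rewrite mcoeffZ -mpolyXD mcoeffX mnm1D_eq -surjective_pairing.
rewrite (bigD1 (a, b)) //= eqxx mulr1; case: eqVneq => [->|ab].
  by rewrite big1 ?addr0 // => p /negbTE ->; rewrite mulr0.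
rewrite (bigD1 (b, a)) /=; last by rewrite xpair_eqE (eq_sym b) (negbTE ab).
rewrite eqxx orbT mulr1 big1 ?addr0 // => p /andP[/negbTE -> /negbTE ->].
by rewrite mulr0.
Qed.

Definition forms_of theta : X :=
  [ffun i => (hproj 1 (mean_form (theta i).1), hproj 2 (cov_form (theta i).2))].

(** Off the diagonal the coefficient of X_a X_b collects two equal entries of a symmetric matrix,
    hence the division by 2. *)
Definition params_of x : params K n m :=
  [ffun i => (\col_a (val (x i).1)@_(U_(a)),
    \matrix_(a, b) ((val (x i).2)@_(U_(a) + U_(b)) / (if a == b then 1 else 2%:R)))].

Lemma params_of_sym x : sym_params (params_of x).
Proof.
move=> i; apply/matrixP => a b; rewrite !ffunE !mxE eq_sym.
by congr (_@__ / _); rewrite addmC.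
Qed.

Lemma forms_ofK theta : sym_params theta -> params_of (forms_of theta) = theta.
Proof.
move=> sym; apply/ffunP => i; rewrite !ffunE [RHS]surjective_pairing /=.
have two0 : (2%:R : K) != 0 by rewrite pnatr_eq0.
congr pair.
  apply/colP => a; rewrite mxE [pihomog _ _ _]pihomog_dE ?mean_form_homog //.
  by rewrite mcoeff_mean_form.
apply/matrixP => a b; rewrite mxE [pihomog _ _ _]pihomog_dE ?cov_form_homog //.
rewrite mcoeff_cov_form; case: eqP => [->|_]; first by rewrite divr1.
have -> : (theta i).2 b a = (theta i).2 a b by rewrite -[in LHS](sym i) mxE.
by rewrite -[X in X / _]mulr2n -[X in X / _]mulr_natr mulfK.
Qed.

Lemma params_ofK x : forms_of (params_of x) = x.
Proof.
apply/ffunP => i; rewrite !ffunE /= [RHS]surjective_pairing; congr pair; apply: val_inj.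
  rewrite hprojE ?mean_form_homog //.
  rewrite [RHS](lin_form_coeff (dhomog_is_dhomog _)).
  by apply: eq_bigr => a _; rewrite mxE.
rewrite hprojE ?cov_form_homog //; apply/mpolyP => k.
have [k2|k2] := eqVneq (mdeg k) 2; last first.
  by rewrite !(@dhomog_nemf_coeff _ _ mdeg 2) ?cov_form_homog ?dhomog_is_dhomog.
have [a [k1 [-> /mnm_peel[b [k0 [->]]]]]] := mnm_peel k2.
move=> /eqP; rewrite mdeg_eq0 => /eqP ->; rewrite addm0 mcoeff_cov_form !mxE.
have two0 : (2%:R : K) != 0 by rewrite pnatr_eq0.
rewrite [b == a]eq_sym; case: eqP => _; first by rewrite divr1.
by rewrite [(U_(b) + U_(a))%MM]addmC -mulrDl -[X in X / _]mulr2n -[X in X / _]mulr_natr mulfK.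
Qed.

(** Undoes the flattening of [coords], so that the forms can be seen to depend linearly on the
    flattened entries. *)
Definition params_of_row (u : 'rV[K]_(m * (n + n * n))) : params K n m :=
  [ffun i => let w := row i (vec_mx u) in ((lsubmx w)^T, vec_mx (rsubmx w))].

Lemma params_of_row_coords theta : params_of_row (\row_k coords theta k) = theta.
Proof.
apply/ffunP => i; rewrite ffunE /coords.
have -> : \row_k mxvec (\matrix_(i < m) row_mx (theta i).1^T (mxvec (theta i).2)) 0 k =
    mxvec (\matrix_(i < m) row_mx (theta i).1^T (mxvec (theta i).2)).
  by apply/rowP => k; rewrite mxE.
by rewrite mxvecK rowK row_mxKl row_mxKr trmxK mxvecK -surjective_pairing.
Qed.

Lemma forms_of_row_linear : linear (fun u => forms_of (params_of_row u)).
Proof.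
move=> a u v; apply/ffunP => i; rewrite !ffunE /=.
have lin_pair d d' (p p' q : {mpoly K[n]}) (s s' t : {mpoly K[n]}) :
    t = a *: p + p' -> q = a *: s + s' ->
    (hproj d t, hproj d' q) = a *: (hproj d p, hproj d' s) + (hproj d p', hproj d' s').
  by move=> -> ->; rewrite !linearP.
apply: lin_pair.
  rewrite /mean_form scaler_sumr -big_split; apply: eq_bigr => k _ /=.
  by rewrite scalerA -scalerDl !linearP /= !mxE.
rewrite /cov_form scaler_sumr -big_split; apply: eq_bigr => k _ /=.
rewrite scaler_sumr -big_split; apply: eq_bigr => l _ /=.
by rewrite scalerA -scalerDl !linearP /= !mxE.
Qed.

End Coordinates.

(** * Finiteness of the fibers and the final count *)

Lemma finite_root_tuples (K : closedFieldType) (M : nat) (T : Type)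
    (r : 'I_M -> {poly K}) (F : ('I_M -> K) -> T) :
  (forall j, r j != 0) ->
  finite_set (F @` [set w | forall j, root (r j) (w j)])%classic.
Proof.
move=> r0; have /fin_all_exists[s sP] j : exists s : seq K, forall z, root (r j) z -> z \in s.
  have [s rE] := closed_field_poly_normal (r j); exists s => z.
  by rewrite rE rootZ ?lead_coef_eq0 // root_prod_XsubC.
pose B := (\max_j size (s j))%N.
(* A tuple of roots is encoded by the positions of its entries in the root lists, which form a
   finite type. *)
pose G (g : {ffun 'I_M -> 'I_B.+1}) := F (fun j => nth 0 (s j) (g j)).
apply: (@sub_finite_set _ _ (G @` [set: {ffun 'I_M -> 'I_B.+1}])%classic); last first.
  exact: finite_image.
move=> _ [w rw <-]; exists [ffun j => inord (index (w j) (s j))] => //.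
rewrite /G; congr F; apply/funext => j; rewrite ffunE.
have wj := sP j _ (rw j).
have lt : (index (w j) (s j) < B)%N.
  by apply: leq_trans (leq_bigmax j); rewrite index_mem.
by rewrite inordK ?nth_index // ltnW.
Qed.

Section Identifiability.
Variables (K : numClosedFieldType) (n' r s : nat).
Local Notation n := n'.+1.
Local Notation m := (r + s)%N.
Local Notation X := {ffun 'I_m -> dhomog n K 1 * dhomog n K 2}.

Definition is_gaussian (i : 'I_m) : bool := (i < r)%N.

Lemma mixture5E (theta : params K n m) :
  mixture5 r s theta = mixture is_gaussian (forms_of theta).
Proof.
rewrite /mixture big_split_ord /=; congr (_ + _); apply: eq_bigr => i _; rewrite ffunE.
  have -> : is_gaussian (lshift s i) = true by exact: (ltn_ord i).
  rewrite /= !(pihomog_dE (mean_form_homog _)) !(pihomog_dE (cov_form_homog _)).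
  by rewrite /gauss5 /moment5 !scaler_nat.
have -> : is_gaussian (rshift r i) = false by rewrite /is_gaussian ltnNge leq_addr.
rewrite /= !(pihomog_dE (mean_form_homog _)) !(pihomog_dE (cov_form_homog _)).
by rewrite /laplace5 /moment5 !scaler_nat.
Qed.

Lemma algebraically_identifiable5_of_inj (x0 : X) :
  lker (linfun (dmixture is_gaussian x0)) = 0%VS -> algebraically_identifiable5 K n r s.
Proof.
move=> /mixture_generic_fiber[P P0 PF].
pose b := vbasis {: X}.
pose psi k (u : 'rV[K]_(m * (n + n * n))) : K := coord b k (forms_of (params_of_row u)).
have psi_lin k u : psi k u = \sum_j psi k (delta_mx 0 j) * u 0 j.
  have fl : scalar (psi k) by move=> a v w; rewrite /psi forms_of_row_linear linearP.
  pose fL : {linear 'rV[K]_(m * (n + n * n)) -> K^o} :=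
    HB.pack (psi k) (GRing.isLinear.Build _ _ _ _ (psi k) fl).
  rewrite {1}[u]row_sum_delta -[psi k]/(fL : _ -> _) linear_sum; apply: eq_bigr => j _.
  by rewrite linearZ mulrC.
(* The condition [P] on coordinates of forms is pulled back along a linear map to a polynomial in
   all mean and matrix entries. *)
pose P' := P \mPo [tuple lin_form (fun j => psi k (delta_mx 0 j)) | k < \dim {: X}].
have P'E theta : P'.@[coords theta] = P.@[fun k => coord b k (forms_of theta)].
  rewrite /P' comp_mpoly_meval; apply: meval_eq => k; rewrite tnth_mktuple.
  have := psi_lin k (\row_j coords theta j); rewrite {1}/psi params_of_row_coords => ->.
  rewrite /lin_form raddf_sum; apply: eq_bigr => j _.
  by rewrite /= mevalZ mevalXU mxE.
exists P'; split.
  have [y Py] := mpoly_nonroot P0; exists (params_of (vec y)); first exact: params_of_sym.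
  rewrite P'E params_ofK; apply: contraNneq Py => <-; apply/eqP/meval_eq => k.
  by rewrite /vec coord_sum_free ?(basis_free (vbasisP _)).
move=> theta _; rewrite P'E => /PF[rt [rt0 rtF]].
apply: sub_finite_set (finite_root_tuples (fun w => params_of (vec w)) rt0).
move=> theta' [sym mE]; exists (fun k => coord b k (forms_of theta')) => [j|].
  by apply: rtF; rewrite vec_coord -!mixture5E.
by rewrite vec_coord forms_ofK.
Qed.

End Identifiability.

Theorem identifiable_of_count (K : numClosedFieldType) (n r s : nat) : (0 < n)%N ->
  ((r + s + ('C(n + 1, 2) + n)) * ('C(n + 1, 2) + n) <= 'C(n + 4, 5))%N ->
  algebraically_identifiable5 K n r s.
Proof.
(* For n = 1 the bound would read (r + s + 2) * 2 <= 1, so there are at least two variables. *)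
case: n => // n' _ le; have n'0 : (0 < n')%N.
  case: n' le => //; rewrite !addn2 //.
have [|x dimx] := @sum_general_full_dim K _ _ _ (@tangent_space K n') _
  (@tangent_space_lift K n') (@dim_tangent_space K n')
  (fun b => dim_tangent_space_general K b n'0) _ _ _ (@GLact_inj K n')
  (@tangent_space_equivariant K n') (@GLact_irreducible K n') _ (@is_gaussian r s).
  by rewrite dim_quintics.
pose x0 : {ffun 'I_(r + s) -> _} := [ffun i => x i].
apply: (@algebraically_identifiable5_of_inj K n' r s x0).
apply: (@dmixture_inj K n' (r + s) (@is_gaussian r s) x0).
have -> : (\sum_i tangent_space (is_gaussian i) (x0 i) =
    \sum_i tangent_space (is_gaussian i) (x i))%VS.
  by apply: eq_bigr => i _; rewrite ffunE.
exact: dimx.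
Qed.

Theorem theorem4p6 (R : realType) (n r s : nat) (hn : (0 < n)%N)
    (hrs : (r + s)%:R <= 'C(n + 4, 5)%:R / ('C(n + 1, 2) + n)%:R
                         - ('C(n + 1, 2) + n)%:R :> rat) :
  algebraically_identifiable5 (complex R) n r s.
Proof.
apply: identifiable_of_count => //; set N := ('C(n + 1, 2) + n)%N in hrs *.
have N0 : 0 < N%:R :> rat by rewrite ltr0n addn_gt0 hn orbT.
by rewrite -(ler_nat rat) natrM natrD -ler_pdivlMr // -lerBrDr.
Qed.
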